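(* Let $(M,g)$ be an $m$-dimensional submanifold of a space form $(N(c),h)$ admitting a concircular vector field $\xi$ with nonzero (i.e. nowhere vanishing) concircular function $f$. Then $(M,g)$ is a generalized $\xi$-parallel submanifold if and only if $$(m-2)\operatorname{grad}^{M}f=0\quad\text{and}\quad fH-(\operatorname{grad}^{N}f)^{\perp}=0.$$ Moreover, if $m\neq2$, then $(M,g)$ is a generalized $\xi$-parallel submanifold if and only if the function $f$ is constant on $M$ and $fH=\operatorname{grad}^{N}f$ along $M$.
   Context: Manifolds are connected. $(N(c),h)$ is a Riemannian manifold of constant sectional curvature $c$; $\mathbf{i}:(M,g)\hookrightarrow(N,h)$ is the inclusion and $g=\mathbf{i}^*h$ is the induced metric. $\nabla^M,\nabla^N$ are the Levi-Civita connections and $\operatorname{grad}^M,\operatorname{grad}^N$ the gradient operators of $(M,g),(N,h)$; $\operatorname{grad}^Mf$ means the gradient of the restriction $f|_M$. $B$ is the second fundamental form of $M$, $H=\frac1m\operatorname{Tr}B$ is its mean curvature vector field, and $\perp$ denotes the component normal to $M$. A vector field $\xi$ on $N$ is concircular with concircular function $f\in C^\infty(N)$ if $\nabla^N_X\xi=fX$ for all $X\in\Gamma(TN)$. For a smooth map $\varphi:(M,g)\to(N,h)$ and a vector field $\xi$ on $N$, the $\xi$-tension field is $$\tau_\xi(\varphi)=\sum_{i}R^N\big(\xi\circ\varphi,\sigma(d\varphi(e_i))\big)d\varphi(e_i)+\sigma^*\Big(\sum_i\big(\nabla^\varphi_{e_i}\nabla^\varphi_{e_i}(\xi\circ\varphi)-\nabla^\varphi_{\nabla^M_{e_i}e_i}(\xi\circ\varphi)\big)\Big),$$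 where $\{e_i\}$ is any local orthonormal frame on $M$, $\nabla^\varphi$ is the pullback connection on $\varphi^{-1}TN$, $R^N(X,Y)Z=\nabla^N_X\nabla^N_YZ-\nabla^N_Y\nabla^N_XZ-\nabla^N_{[X,Y]}Z$, $\sigma(X)=\nabla^N_X\xi$, and $\sigma^*$ is the pointwise adjoint of $\sigma$ with respect to $h$. The submanifold $(M,g)$ is generalized $\xi$-parallel if $\tau_\xi(\mathbf{i})=0$. *)

(* Defs.v *)
From HB Require Import structures.
From mathcomp Require Import all_boot all_order all_algebra.
From mathcomp Require Import all_classical all_reals all_analysis.

Set Implicit Arguments.
Unset Strict Implicit.
Unset Printing Implicit Defensive.

Import Order.TTheory GRing.Theory Num.Theory.
Import numFieldNormedType.Exports.
Local Open Scope classical_set_scope.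
Local Open Scope ring_scope.

Fixpoint Ck_on (R : realType) (n k : nat) (U : set 'rV[R]_n)
    (f : 'rV[R]_n -> R) : Prop :=
  match k with
  | 0 => forall x, U x -> {for x, continuous f}
  | k'.+1 => (forall x, U x -> differentiable f x) /\
             (forall v, Ck_on k' U (fun x => 'D_v f x))
  end.

Definition smooth_on (R : realType) (n : nat) (U : set 'rV[R]_n)
    (f : 'rV[R]_n -> R) : Prop :=
  forall k, Ck_on k U f.

(* The functions are total; a chart is a homeomorphism between the open sets
   [cdom] and [cmap @` cdom], and its values elsewhere are irrelevant. *)
Record chart (R : realType) (n : nat) (T : topologicalType) := Chart {
  cdom : set T;
  cmap :> T -> 'rV[R]_n;
  cinv : 'rV[R]_n -> T;
  cdom_open : open cdom;
  ccod_open : open (cmap @` cdom);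
  cmapK : forall p, cdom p -> cinv (cmap p) = p;
  cmap_continuous : forall p, cdom p -> {for p, continuous cmap};
  cinv_continuous : forall x, (cmap @` cdom) x -> {for x, continuous cinv} }.

(* The atlas is given as a family containing a preferred chart [chart_at p]
   around every point p.  The tangent space at p is identified with R^n through
   the coordinate basis of [chart_at p]: throughout, a tangent vector at p is an
   element of ['rV[R]_n] holding its components in [chart_at p]. *)
Record manifold (R : realType) (n : nat) := Manifold {
  carrier :> topologicalType;
  chart_at : carrier -> chart R n carrier;
  chart_at_dom : forall p, cdom (chart_at p) p;
  transition_smooth : forall p q (j : 'I_n),
    smooth_on (chart_at p @` (cdom (chart_at p) `&` cdom (chart_at q)))
              (fun x => chart_at q (cinv (chart_at p) x) 0 j);
  manifold_hausdorff : hausdorff_space carrier;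
  manifold_second_countable : @second_countable carrier;
  manifold_connected : connected [set: carrier] }.

Definition smooth_near (R : realType) (m : nat) (M : manifold R m) (p : M)
    (f : M -> R) : Prop :=
  exists U : set 'rV[R]_m, [/\ open U, U (chart_at p p) &
    smooth_on U (fun x => f (cinv (chart_at p) x))].

Definition smooth (R : realType) (m : nat) (M : manifold R m) (f : M -> R) :=
  forall p, smooth_near p f.

Definition fdiff (R : realType) (m : nat) (M : manifold R m) (f : M -> R)
    (p : M) (v : 'rV[R]_m) : R :=
  'D_v (fun x => f (cinv (chart_at p) x)) (chart_at p p).

Definition smooth_map (R : realType) (m n : nat) (M : manifold R m)
    (N : manifold R n) (F : M -> N) : Prop :=
  continuous F /\
  forall p (j : 'I_n), smooth_near p (fun q => chart_at (F p) (F q) 0 j).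

Definition tdiff (R : realType) (m n : nat) (M : manifold R m)
    (N : manifold R n) (F : M -> N) (p : M) (v : 'rV[R]_m) : 'rV[R]_n :=
  'D_v (fun x => chart_at (F p) (F (cinv (chart_at p) x))) (chart_at p p).

(* Components, in the chart [chart_at p], of the tangent vector w at q. *)
Definition tcoord (R : realType) (n : nat) (N : manifold R n) (p q : N)
    (w : 'rV[R]_n) : 'rV[R]_n :=
  'D_w (fun x => chart_at p (cinv (chart_at q) x)) (chart_at q q).

(* The vector field on the domain of [chart_at p] whose components in that chart
   are constantly v: for v the j-th basis vector it is the coordinate field
   d/dx^j, and in general it extends the tangent vector v at p. *)
Definition cst_field (R : realType) (n : nat) (N : manifold R n) (p : N)
    (v : 'rV[R]_n) (q : N) : 'rV[R]_n :=
  'D_v (fun x => chart_at q (cinv (chart_at p) x)) (chart_at p q).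

(* Local vector fields near p are represented by total functions. *)
Definition vfield_smooth_near (R : realType) (n : nat) (N : manifold R n)
    (p : N) (X : N -> 'rV[R]_n) : Prop :=
  forall j : 'I_n, smooth_near p (fun q => tcoord p q (X q) 0 j).

Definition vfield_smooth (R : realType) (n : nat) (N : manifold R n)
    (X : N -> 'rV[R]_n) : Prop :=
  forall p, vfield_smooth_near p X.

Definition lie_bracket (R : realType) (n : nat) (N : manifold R n)
    (X Y : N -> 'rV[R]_n) (p : N) : 'rV[R]_n :=
  \row_j (fdiff (fun q => tcoord p q (Y q) 0 j) p (X p)
          - fdiff (fun q => tcoord p q (X q) 0 j) p (Y p)).

(* A metric is given by its Gram matrix [h p] on the tangent space at p. *)
Definition ip (R : realType) (n : nat) (T : Type) (h : T -> 'M[R]_n) (p : T)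
    (u v : 'rV[R]_n) : R :=
  (u *m h p *m v^T) 0 0.

Record riemannian_metric (R : realType) (n : nat) (N : manifold R n)
    (h : N -> 'M[R]_n) : Prop := {
  metric_sym : forall p u v, ip h p u v = ip h p v u;
  metric_pos : forall p u, u != 0 -> 0 < ip h p u u;
  metric_smooth : forall p u v,
    smooth_near p (fun q => ip h q (cst_field p u q) (cst_field p v q)) }.

(* [nabla X p v] is the covariant derivative of X at p in the direction of the
   tangent vector v at p.  Connections act on local vector fields; the values of
   [nabla] on fields that are not smooth near p are irrelevant. *)
Record affine_connection (R : realType) (n : nat) (N : manifold R n)
    (nabla : (N -> 'rV[R]_n) -> N -> 'rV[R]_n -> 'rV[R]_n) : Prop := {
  nabla_linear : forall p X, vfield_smooth_near p X ->
    forall (a : R) u v, nabla X p (a *: u + v) = a *: nabla X p u + nabla X p v;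
  nabla_add : forall p X Y, vfield_smooth_near p X -> vfield_smooth_near p Y ->
    forall v, nabla (fun q => X q + Y q) p v = nabla X p v + nabla Y p v;
  nabla_leibniz : forall p (f : N -> R) X,
    smooth_near p f -> vfield_smooth_near p X ->
    forall v, nabla (fun q => f q *: X q) p v
              = fdiff f p v *: X p + f p *: nabla X p v;
  nabla_smooth : forall p X Y, vfield_smooth_near p X -> vfield_smooth_near p Y ->
    vfield_smooth_near p (fun q => nabla X q (Y q)) }.

Record levi_civita (R : realType) (n : nat) (N : manifold R n)
    (h : N -> 'M[R]_n)
    (nabla : (N -> 'rV[R]_n) -> N -> 'rV[R]_n -> 'rV[R]_n) : Prop := {
  lc_connection : affine_connection nabla;
  lc_torsion_free : forall p X Y,
    vfield_smooth_near p X -> vfield_smooth_near p Y ->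
    nabla Y p (X p) - nabla X p (Y p) = lie_bracket X Y p;
  lc_metric : forall p X Y, vfield_smooth_near p X -> vfield_smooth_near p Y ->
    forall v, fdiff (fun q => ip h q (X q) (Y q)) p v
              = ip h p (nabla X p v) (Y p) + ip h p (X p) (nabla Y p v) }.

(* R(X,Y)Z = nabla_X nabla_Y Z - nabla_Y nabla_X Z - nabla_[X,Y] Z. *)
Definition curvature (R : realType) (n : nat) (N : manifold R n)
    (nabla : (N -> 'rV[R]_n) -> N -> 'rV[R]_n -> 'rV[R]_n)
    (X Y Z : N -> 'rV[R]_n) (p : N) : 'rV[R]_n :=
  nabla (fun q => nabla Z q (Y q)) p (X p)
  - nabla (fun q => nabla Z q (X q)) p (Y p)
  - nabla Z p (lie_bracket X Y p).

(* The curvature being tensorial, its value on tangent vectors at p is computed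
   on any local extensions of them. *)
Definition curvature_at (R : realType) (n : nat) (N : manifold R n)
    (nabla : (N -> 'rV[R]_n) -> N -> 'rV[R]_n -> 'rV[R]_n)
    (p : N) (u v w : 'rV[R]_n) : 'rV[R]_n :=
  curvature nabla (cst_field p u) (cst_field p v) (cst_field p w) p.

Definition sectional_curvature (R : realType) (n : nat) (N : manifold R n)
    (h : N -> 'M[R]_n)
    (nabla : (N -> 'rV[R]_n) -> N -> 'rV[R]_n -> 'rV[R]_n)
    (p : N) (u v : 'rV[R]_n) : R :=
  ip h p (curvature_at nabla p u v v) u
  / (ip h p u u * ip h p v v - ip h p u v ^+ 2).

Definition constant_sectional_curvature (R : realType) (n : nat)
    (N : manifold R n) (h : N -> 'M[R]_n)
    (nabla : (N -> 'rV[R]_n) -> N -> 'rV[R]_n -> 'rV[R]_n) (c : R) : Prop :=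
  forall p u v, row_free (col_mx u v) ->
    sectional_curvature h nabla p u v = c.

(* Riesz representation: the tangent vector w at p with <w, u> = alpha u. *)
Definition sharp (R : realType) (n : nat) (T : Type) (h : T -> 'M[R]_n) (p : T)
    (alpha : 'rV[R]_n -> R) : 'rV[R]_n :=
  xget 0 [set w | forall u, ip h p w u = alpha u].

Definition grad (R : realType) (n : nat) (N : manifold R n) (h : N -> 'M[R]_n)
    (f : N -> R) (p : N) : 'rV[R]_n :=
  sharp h p (fdiff f p).

Definition adjoint_at (R : realType) (n : nat) (T : Type) (h : T -> 'M[R]_n)
    (p : T) (A : 'rV[R]_n -> 'rV[R]_n) (v : 'rV[R]_n) : 'rV[R]_n :=
  sharp h p (fun u => ip h p (A u) v).

(* Pullback connection along F on sections V of F^{-1}TN: writing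
   V = sum_j V^j (d_j o F) in the coordinates around F p,
   nabla^F_v V = sum_j (v(V^j) d_j + V^j nabla_{dF v} d_j). *)
Definition pullback_connection (R : realType) (m n : nat) (M : manifold R m)
    (N : manifold R n) (nabla : (N -> 'rV[R]_n) -> N -> 'rV[R]_n -> 'rV[R]_n)
    (F : M -> N) (V : M -> 'rV[R]_n) (p : M) (v : 'rV[R]_m) : 'rV[R]_n :=
  \sum_(j < n)
    (fdiff (fun q => tcoord (F p) (F q) (V q) 0 j) p v *: delta_mx 0 j
     + V p 0 j *: nabla (cst_field (F p) (delta_mx 0 j)) (F p) (tdiff F p v)).

(* Submanifolds are the images of injective immersions; embedded submanifolds,
   for which iota is moreover a topological embedding, are included. *)
Record submanifold (R : realType) (m n : nat) (M : manifold R m)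
    (N : manifold R n) (iota : M -> N) : Prop := {
  sub_smooth : smooth_map iota;
  sub_injective : injective iota;
  sub_immersion : forall p, injective (tdiff iota p) }.

Definition induced_metric (R : realType) (m n : nat) (M : manifold R m)
    (N : manifold R n) (h : N -> 'M[R]_n) (iota : M -> N) (p : M) : 'M[R]_m :=
  \matrix_(i, j) ip h (iota p) (tdiff iota p (delta_mx 0 i))
                               (tdiff iota p (delta_mx 0 j)).

(* w minus its tangential part d iota(t), where t is determined by
   g(t, u) = h(w, d iota(u)) for all u tangent to M. *)
Definition normal_part (R : realType) (m n : nat) (M : manifold R m)
    (N : manifold R n) (h : N -> 'M[R]_n) (iota : M -> N) (p : M)
    (w : 'rV[R]_n) : 'rV[R]_n :=
  w - tdiff iota p (sharp (induced_metric h iota) p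
                      (fun u => ip h (iota p) w (tdiff iota p u))).

(* B(u, v) = (nabla^N_u V)^perp for any extension V of v tangent to M. *)
Definition second_fundamental_form (R : realType) (m n : nat)
    (M : manifold R m) (N : manifold R n) (h : N -> 'M[R]_n)
    (nabla : (N -> 'rV[R]_n) -> N -> 'rV[R]_n -> 'rV[R]_n)
    (iota : M -> N) (p : M) (u v : 'rV[R]_m) : 'rV[R]_n :=
  normal_part h iota p
    (pullback_connection nabla iota
       (fun q => tdiff iota q (cst_field p v q)) p u).

(* H = (1/m) Tr_g B, with Tr_g B = sum_ij g^ij B(d_i, d_j). *)
Definition mean_curvature (R : realType) (m n : nat)
    (M : manifold R m) (N : manifold R n) (h : N -> 'M[R]_n)
    (nabla : (N -> 'rV[R]_n) -> N -> 'rV[R]_n -> 'rV[R]_n)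
    (iota : M -> N) (p : M) : 'rV[R]_n :=
  m%:R^-1 *: \sum_(i < m) \sum_(j < m)
    invmx (induced_metric h iota p) i j *:
      second_fundamental_form h nabla iota p (delta_mx 0 i) (delta_mx 0 j).

Definition orthonormal_frame_near (R : realType) (m : nat) (M : manifold R m)
    (g : M -> 'M[R]_m) (p : M) (e : 'I_m -> M -> 'rV[R]_m) : Prop :=
  (forall i, vfield_smooth_near p (e i)) /\
  (\forall q \near p, forall i j, ip g q (e i q) (e j q) = (i == j)%:R).

Definition xi_tension (R : realType) (m n : nat)
    (M : manifold R m) (N : manifold R n) (h : N -> 'M[R]_n)
    (nablaM : (M -> 'rV[R]_m) -> M -> 'rV[R]_m -> 'rV[R]_m)
    (nablaN : (N -> 'rV[R]_n) -> N -> 'rV[R]_n -> 'rV[R]_n)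
    (xi : N -> 'rV[R]_n) (phi : M -> N)
    (e : 'I_m -> M -> 'rV[R]_m) (p : M) : 'rV[R]_n :=
  let sigma := nablaN xi (phi p) in
  let nablaphi := pullback_connection nablaN phi in
  let xiphi := fun q => xi (phi q) in
  \sum_(i < m) curvature_at nablaN (phi p) (xiphi p)
                 (sigma (tdiff phi p (e i p))) (tdiff phi p (e i p))
  + adjoint_at h (phi p) sigma
      (\sum_(i < m)
        (nablaphi (fun q => nablaphi xiphi q (e i q)) p (e i p)
         - nablaphi xiphi p (nablaM (e i) p (e i p)))).

(* tau_xi(iota) = 0; tau_xi at p may be computed in any orthonormal frame
   around p. *)
Definition generalized_xi_parallel (R : realType) (m n : nat)
    (M : manifold R m) (N : manifold R n) (h : N -> 'M[R]_n)
    (nablaM : (M -> 'rV[R]_m) -> M -> 'rV[R]_m -> 'rV[R]_m)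
    (nablaN : (N -> 'rV[R]_n) -> N -> 'rV[R]_n -> 'rV[R]_n)
    (xi : N -> 'rV[R]_n) (iota : M -> N) : Prop :=
  forall p e, orthonormal_frame_near (induced_metric h iota) p e ->
    xi_tension h nablaM nablaN xi iota e p = 0.

Definition concircular (R : realType) (n : nat) (N : manifold R n)
    (nabla : (N -> 'rV[R]_n) -> N -> 'rV[R]_n -> 'rV[R]_n)
    (xi : N -> 'rV[R]_n) (f : N -> R) : Prop :=
  [/\ vfield_smooth xi, smooth f & forall p v, nabla xi p v = f p *: v].

(* Main.v *)
(** A concircular field satisfies [R(X,Y)xi = df(X) Y - df(Y) X], so that the pair
symmetry of the curvature tensor gives
  [<R(xi,X)Y,Z> = <R(Y,Z)xi,X> = df(Y)<Z,X> - df(Z)<Y,X>],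
and the trace of [R(xi, sigma(X))X] over an orthonormal frame of [M] is
[f (grad^M f - m grad^N f)].  The rough Laplacian of [xi] along the inclusion is
[grad^M f + m f H] by the Gauss formula, and [sigma^* = f id].  Altogether
  [tau_xi = f ((2 - m) grad^M f + m (f H - (grad^N f)^perp))],
whose tangential and normal parts vanish separately. *)

Require Import Defs.
From mathcomp Require Import all_boot all_order all_algebra.
From mathcomp Require Import all_classical all_reals all_analysis.
From mathcomp Require Import ring lra.
Set Implicit Arguments.
Unset Strict Implicit.
Unset Printing Implicit Defensive.
Import Order.TTheory GRing.Theory Num.Theory.
Import numFieldNormedType.Exports.
Local Open Scope classical_set_scope.
Local Open Scope ring_scope.

(** Tangent vectors at q are stored in the chart chosen at q, and this choice need not vary
    continuously with q. A field can therefore be differentiated only after its components are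
    carried into one fixed chart, and most identities are proved for germs. [curvature_at] evaluates
    the connection on coordinate fields, so brackets vanish and the symmetries of curvature come
    down to the equality of mixed partial derivatives. It sees xi only through the coordinate field
    with value xi(p); metric skewness bridges this gap, because it moves both derivatives onto the
    other argument and leaves only the value of the field at p. That the tangential part of the
    ambient derivative is the intrinsic derivative is proved by the argument for uniqueness of the
    Levi-Civita connection. Being parallel quantifies over orthonormal frames, so a smooth frame has
    to be constructed near every point before the condition can be exploited. For m different from
    2, connectedness of M turns grad^M f = 0 into constancy. *)

Lemma near_eq_differentiable (R : numFieldType) (V W : normedModType R)
    (f g : V -> W) (x : V) :
  (\forall y \near x, f y = g y) -> differentiable f x -> differentiable g x.
Proof.
move=> fg df; have -> : g = f + (g - f) by rewrite addrC subrK.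
apply: differentiableD => //; set d := g - f.
have d0 : \forall y \near x, d y = 0.
  by near=> y; rewrite /d fctE -(near fg y) ?subrr.
have dx0 : d x = 0 by exact: nbhs_singleton d0.
have d0' : \forall h \near (0 : V), d (h + x) = 0.
  rewrite (near_shift x) /=; near=> y; rewrite /= sub0r subrK; near: y; exact: d0.
(* The zero map fits the first-order expansion of [d] with a remainder that vanishes near 0, so by
   uniqueness it is the differential of [d]. *)
have ed : d \o shift x = cst (d x) + (\0 : {linear V -> W}) +o_ 0 id.
  apply/eqaddoP => e e0; apply: filterS d0' => h dh.
  by rewrite /= !fctE /= dx0 addr0 subr0 dh normr0 mulr_ge0// ltW.
have c0 : continuous ((\0 : {linear V -> W}) : V -> W) by exact: cst_continuous.
by apply/diff_locallyP; rewrite (diff_unique c0 ed).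
Unshelve. all: by end_near. Qed.

Lemma near_eq_continuous (T U : topologicalType) (f g : T -> U) (x : T) :
  (\forall y \near x, f y = g y) -> {for x, continuous f} -> {for x, continuous g}.
Proof.
move=> fg cf; rewrite /prop_for /continuous_at -(nbhs_singleton fg).
by apply: cvg_trans cf; exact: near_eq_cvg.
Qed.

(** * Differential calculus on row vectors *)

Section Derivatives.
Variable R : realType.

Lemma derive_line (V : normedModType R) (f : V -> R) (x v : V) (t : R) :
  derivable f (x + t *: v) v ->
  is_derive t 1 (fun s : R => f (x + s *: v)) ('D_v f (x + t *: v)).
Proof.
have E : (fun h : R => h^-1 *: (((fun s : R => f (x + s *: v)) \o shift t) (h *: 1)
            - f (x + t *: v))) =
  (fun h => h^-1 *: ((f \o shift (x + t *: v)) (h *: v) - f (x + t *: v))).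
  apply/funext => h /=; congr (_ *: (f _ - _)).
  by rewrite [_ *: 1]mulr1 scalerDl addrCA.
by move=> df; split; rewrite /derivable /derive E.
Qed.

Lemma differentiable_rV (V : normedModType R) n (G : V -> 'rV[R]_n) x :
  (forall j, differentiable (fun y => G y 0 j) x) -> differentiable G x.
Proof.
move=> dG; have -> : G = \sum_(j < n) (fun y => G y 0 j *: delta_mx 0 j).
  apply/funext => y; rewrite fct_sumE; exact: row_sum_delta.
by apply: differentiable_sum => j; apply: differentiableZl.
Qed.

Lemma derive_coord (V : normedModType R) n (G : V -> 'rV[R]_n) x v j :
  differentiable G x -> ('D_v G x) 0 j = 'D_v (fun y => G y 0 j) x.
Proof. by move=> dG; rewrite derive_mx ?mxE//; apply: diff_derivable. Qed.

Lemma derive_linear (V W : normedModType R) (f : V -> W) x a u v :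
  differentiable f x -> 'D_(a *: u + v) f x = a *: 'D_u f x + 'D_v f x.
Proof. by move=> df; rewrite !deriveE// linearP. Qed.

Lemma derive_sum_dir n (W : normedModType R) (f : 'rV[R]_n -> W) x v :
  differentiable f x -> 'D_v f x = \sum_(j < n) v 0 j *: 'D_(delta_mx 0 j) f x.
Proof.
move=> df; rewrite deriveE// {1}(row_sum_delta v) linear_sum.
by apply: eq_bigr => j _; rewrite linearZ deriveE.
Qed.

Lemma derive_compose (U V W : normedModType R) (f : V -> W) (G : U -> V) x v :
  differentiable G x -> differentiable f (G x) ->
  'D_v (f \o G) x = 'D_('D_v G x) f (G x).
Proof.
move=> dG df; have dfG := differentiable_comp dG df.
by rewrite (deriveE _ dfG) (deriveE _ dG) (deriveE _ df) (diff_comp dG df).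
Qed.

End Derivatives.

(** * Functions of class C^k and smooth functions on open sets *)

Section Smoothness.
Variable R : realType.
Implicit Types n k : nat.

Lemma Ck_onW n k (U : set 'rV[R]_n) f : Ck_on k.+1 U f -> Ck_on k U f.
Proof.
elim: k f => [|k IH] f [df Df] /=; first by move=> x /df /differentiable_continuous.
by split=> // v; exact/IH/Df.
Qed.

Lemma sub_Ck_on n k (U V : set 'rV[R]_n) f :
  U `<=` V -> Ck_on k V f -> Ck_on k U f.
Proof.
move=> UV; elim: k f => [|k IH] f /=; first by move=> cf x /UV /cf.
by move=> [df Df]; split=> [x /UV /df//|v]; exact/IH/Df.
Qed.

(** Derivatives are taken of total functions, so agreement on [U] is first turned into agreement of
    germs at each point of [U]; this form passes to directional derivatives in the induction. *)
Lemma eq_Ck_on n k (U : set 'rV[R]_n) f g : open U ->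
  (forall x, U x -> f x = g x) -> Ck_on k U f -> Ck_on k U g.
Proof.
move=> oU fg; have {fg} : forall x, U x -> \forall y \near x, f y = g y.
  by move=> x Ux; have xU : nbhs x U by [exact: open_nbhs_nbhs]; exact: filterS fg xU.
elim: k f g => [|k IH] f g nfg /=.
  by move=> cf x Ux; apply: near_eq_continuous (nfg _ Ux) (cf _ Ux).
move=> [df Df]; split=> [x Ux|v].
  exact: near_eq_differentiable (nfg _ Ux) (df _ Ux).
apply: IH (Df v) => x Ux.
by apply: filterS (near_join (nfg _ Ux)) => y; exact: near_eq_derive.
Qed.

Lemma Ck_on_cst n k (U : set 'rV[R]_n) (a : R) : Ck_on k U (fun=> a).
Proof.
elim: k a => [|k IH] a /=; first by move=> x _; exact: cst_continuous.
split=> [x _|v]; first exact: differentiable_cst.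
have -> : (fun x : 'rV[R]_n => 'D_v (fun=> a) x) = (fun=> 0).
  by apply/funext => x; exact: derive_cst.
exact: IH.
Qed.

Lemma Ck_onD n k (U : set 'rV[R]_n) f g : open U ->
  Ck_on k U f -> Ck_on k U g -> Ck_on k U (fun x => f x + g x).
Proof.
move=> oU; elim: k f g => [|k IH] f g /=.
  by move=> cf cg x Ux; apply: continuousD; [exact: cf|exact: cg].
move=> [df Df] [dg Dg]; split=> [x Ux|v].
  by apply: differentiableD; [exact: df|exact: dg].
apply: (@eq_Ck_on _ _ _ (fun x => 'D_v f x + 'D_v g x)) => //; last exact: IH.
by move=> x Ux; rewrite -deriveD//; apply: diff_derivable; [exact: df|exact: dg].
Qed.

Lemma Ck_onM n k (U : set 'rV[R]_n) f g : open U ->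
  Ck_on k U f -> Ck_on k U g -> Ck_on k U (fun x => f x * g x).
Proof.
move=> oU; elim: k f g => [|k IH] f g.
  by move=> cf cg x Ux; apply: continuousM; [exact: (cf x)|exact: (cg x)].
move=> Cf Cg; have [df Df] := Cf; have [dg Dg] := Cg; split=> [x Ux|v].
  by apply: differentiableM; [exact: df|exact: dg].
apply: (@eq_Ck_on _ _ _ (fun x => f x * 'D_v g x + g x * 'D_v f x)) => //.
  by move=> x Ux; rewrite deriveM//; apply: diff_derivable; [exact: df|exact: dg].
apply: Ck_onD => //; apply: IH; do ?[exact: Dg|exact: Df]; exact: Ck_onW.
Qed.

Lemma Ck_on_sum n k (U : set 'rV[R]_n) (I : Type) (r : seq I) F : open U ->
  (forall i, Ck_on k U (F i)) -> Ck_on k U (fun x => \sum_(i <- r) F i x).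
Proof.
move=> oU CF; elim: r => [|i r IH].
  have -> : (fun x => \sum_(i <- [::]) F i x) = (fun=> 0).
    by apply/funext => x; rewrite big_nil.
  exact: Ck_on_cst.
have -> : (fun x => \sum_(j <- i :: r) F j x) =
    (fun x => F i x + \sum_(j <- r) F j x).
  by apply/funext => x; rewrite big_cons.
exact: Ck_onD.
Qed.

Lemma smooth_on_derive n (U : set 'rV[R]_n) f v :
  smooth_on U f -> smooth_on U (fun x => 'D_v f x).
Proof. by move=> sf k; exact: (sf k.+1).2. Qed.

Lemma smooth_on_differentiable n (U : set 'rV[R]_n) f x :
  smooth_on U f -> U x -> differentiable f x.
Proof. by move=> /(_ 1) [+ _]; apply. Qed.

(** By the chain rule D_v (f o G) is the sum of D_v G_j times (d_j f) o G. The induction on [k]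
    generalizes [f], since the second factor is again a smooth function composed with [G]. *)
Lemma Ck_on_comp n n' k (U : set 'rV[R]_n) (V : set 'rV[R]_n') f
    (G : 'rV[R]_n -> 'rV[R]_n') : open U -> smooth_on V f ->
  (forall j, smooth_on U (fun x => G x 0 j)) -> (forall x, U x -> V (G x)) ->
  Ck_on k U (fun x => f (G x)).
Proof.
move=> oU + sG GUV.
have dG x : U x -> differentiable G x.
  move=> Ux; apply: differentiable_rV => j.
  exact: smooth_on_differentiable (sG j) Ux.
elim: k f => [|k IH] f sf.
  move=> x Ux; apply: differentiable_continuous.
  by apply: differentiable_comp; [exact: dG|
    apply: (smooth_on_differentiable sf); exact: GUV].
split=> [x Ux|v].
  by apply: differentiable_comp; [exact: dG|
    apply: (smooth_on_differentiable sf); exact: GUV].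
apply: (@eq_Ck_on _ _ _ (fun x => \sum_(j < n')
   ('D_v (fun y => G y 0 j) x * 'D_(delta_mx 0 j) f (G x)))) => //.
  move=> x Ux; have df : differentiable f (G x).
    by apply: (smooth_on_differentiable sf); exact: GUV.
  rewrite (derive_compose _ (dG _ Ux) df) derive_sum_dir//.
  by apply: eq_bigr => j _; rewrite derive_coord//; exact: dG.
apply: Ck_on_sum => // j; apply: Ck_onM => //.
  exact: smooth_on_derive.
by apply: (IH (fun y => 'D_(delta_mx 0 j) f y)); exact: smooth_on_derive.
Qed.

Lemma smooth_on_comp n n' (U : set 'rV[R]_n) (V : set 'rV[R]_n') f
    (G : 'rV[R]_n -> 'rV[R]_n') : open U -> smooth_on V f ->
  (forall j, smooth_on U (fun x => G x 0 j)) -> (forall x, U x -> V (G x)) ->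
  smooth_on U (fun x => f (G x)).
Proof. by move=> ? ? ? ? k; exact: Ck_on_comp. Qed.

Lemma is_derive_invsqrt (x : R) : 0 < x ->
  is_derive x 1 (fun y => (Num.sqrt y)^-1) (- 2^-1 * (Num.sqrt x)^-1 ^+ 3).
Proof.
move=> x0; have s0 : Num.sqrt x != 0 by rewrite gt_eqF// sqrtr_gt0.
have ds := is_derive1_sqrt x0.
split; first by apply: derivableV.
rewrite deriveV// derive_val /GRing.scale /=.
by field.
Qed.

(** With s = 1 / sqrt f one has D_v s = -(1/2) s^3 D_v f, a polynomial in s itself times a smooth
    function, so C^k regularity of s yields C^(k+1). This serves to normalize vectors in the
    Gram-Schmidt process. *)
Lemma smooth_on_invsqrt n (U : set 'rV[R]_n) f : open U -> smooth_on U f ->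
  (forall x, U x -> 0 < f x) -> smooth_on U (fun x => (Num.sqrt (f x))^-1).
Proof.
move=> oU sf f0.
have dU x : U x -> differentiable (fun y => (Num.sqrt (f y))^-1) x.
  move=> Ux; apply: (@differentiable_comp _ _ _ _ f (fun y => (Num.sqrt y)^-1)).
    exact: smooth_on_differentiable sf Ux.
  by apply/derivable1_diffP; have := is_derive_invsqrt (f0 _ Ux).
elim=> [|k IH]; first by move=> x /dU /differentiable_continuous.
split=> // v.
pose s x := (Num.sqrt (f x))^-1.
apply: (@eq_Ck_on _ _ _ (fun x => (- 2^-1 * (s x * (s x * s x))) * 'D_v f x)) => //.
  move=> x Ux.
  have ds := is_derive_invsqrt (f0 _ Ux).
  have dsx : differentiable (fun y => (Num.sqrt y)^-1) (f x).
    by apply/derivable1_diffP; case: ds.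
  rewrite (@derive_compose _ _ _ _ (fun y => (Num.sqrt y)^-1) f)//; last first.
    exact: smooth_on_differentiable sf Ux.
  rewrite -[in RHS](mulr1 ('D_v f x)) -[in RHS]/('D_v f x *: 1).
  rewrite [in RHS]deriveE// linearZ /= -deriveE// derive_val /GRing.scale /= /s.
  by ring.
apply: Ck_onM => //; last exact: smooth_on_derive.
apply: Ck_onM => //; first exact: Ck_on_cst.
by apply: Ck_onM => //; apply: Ck_onM.
Qed.

End Smoothness.

(** * Symmetry of second derivatives *)

Section Germs.
Variable R : realType.
Implicit Types n k : nat.

Lemma line_MVT (V : normedModType R) (f : V -> R) (y v : V) (d : R) : 0 < d ->
  (forall t, 0 <= t <= d -> differentiable f (y + t *: v)) ->
  exists2 c, 0 <= c <= d & f (y + d *: v) - f y = 'D_v f (y + c *: v) * d.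
Proof.
move=> d0 df; pose g t := f (y + t *: v).
have dg t : 0 <= t <= d -> is_derive t 1 g ('D_v f (y + t *: v)).
  by move=> td; apply: derive_line; apply: diff_derivable; exact: df.
have [||c] := @MVT R g (fun t => 'D_v f (y + t *: v)) 0 d d0.
- by move=> t; rewrite in_itv /= => /andP[/ltW t0 /ltW td]; apply: dg; rewrite t0.
- apply: derivable_within_continuous => t; rewrite in_itv /= => /dg; by case.
rewrite in_itv /= => /andP[/ltW c0 /ltW cd].
by rewrite /g scale0r addr0 subr0 => E; exists c => //; rewrite c0.
Qed.

(** The mean value theorem is used twice: along [u] for the increment f(y + d v) - f(y), then along
    [v] for D_u f. *)
Lemma second_difference n (U : set 'rV[R]_n) f x u v (d : R) : 0 < d ->
  smooth_on U f ->
  (forall s t, 0 <= s <= d -> 0 <= t <= d -> U (x + s *: u + t *: v)) ->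
  exists s t, [/\ 0 <= s <= d, 0 <= t <= d &
    f (x + d *: u + d *: v) - f (x + d *: u) - (f (x + d *: v) - f x) =
    'D_v (fun y => 'D_u f y) (x + s *: u + t *: v) * d * d].
Proof.
move=> d0 sf Ux.
have dd : 0 <= d <= d by rewrite ltW /=.
have zd : (0 : R) <= 0 <= d by rewrite lexx ltW.
have df y : U y -> differentiable f y by exact: smooth_on_differentiable.
have dDf y : U y -> differentiable (fun y => 'D_u f y) y.
  by apply: smooth_on_differentiable; exact: smooth_on_derive.
pose F y := f (y + d *: v) - f y.
have dsh y : differentiable (fun y : 'rV[R]_n => y + d *: v) y.
  by apply: differentiableD.
have dfs y : U (y + d *: v) -> differentiable (fun y => f (y + d *: v)) y.
  move=> Uy; apply: (@differentiable_comp _ _ _ _ (fun y => y + d *: v) f) => //.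
  exact: df.
have Us s : 0 <= s <= d -> U (x + s *: u).
  by move=> sd; have := Ux s 0 sd zd; rewrite scale0r addr0.
have [|s sd E1] := @line_MVT _ F x u d d0.
  by move=> s sd; apply: differentiableB; [apply: dfs; exact: Ux|exact/df/Us].
have [|t td E2] := @line_MVT _ (fun y => 'D_u f y) (x + s *: u) v d d0.
  by move=> t td; apply: dDf; exact: Ux.
exists s, t; split => //; rewrite -E2 -[LHS]/(F _ - F _) E1; congr (_ * _).
rewrite /F deriveB; last 2 first.
- by apply: diff_derivable; apply: dfs; exact: Ux.
- by apply: diff_derivable; exact/df/Us.
congr (_ - _).
rewrite (@derive_compose _ _ _ _ f (fun y => y + d *: v)) //; last exact/df/Ux.
congr ('D_ _ f _); rewrite deriveD// derive_id derive_cst addr0//.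
Qed.

(** The second difference does not change when [u] and [v] are exchanged, so the two mixed
    derivatives agree at two nearby, possibly different, points; continuity of both at [x] closes
    the gap up to [e]. *)
Lemma Schwarz n (U : set 'rV[R]_n) f x u v : open U -> smooth_on U f -> U x ->
  'D_u (fun y => 'D_v f y) x = 'D_v (fun y => 'D_u f y) x.
Proof.
move=> oU sf Ux.
pose A := fun y => 'D_u (fun y => 'D_v f y) y.
pose B := fun y => 'D_v (fun y => 'D_u f y) y.
have cD w w' : {for x, continuous (fun y => 'D_w (fun y => 'D_w' f y) y)}.
  apply: differentiable_continuous.
  by apply: (@smooth_on_differentiable _ _ U) => //; do 2 apply: smooth_on_derive.
apply/eqP; rewrite -subr_eq0 -normr_le0; apply/ler_addgt0Pl => e e0; rewrite addr0.
have e2 : 0 < e / 2 by rewrite divr_gt0.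
have cA := cD u v; have cB := cD v u.
move/cvgrPdist_lt/(_ _ e2) : cA => nA.
move/cvgrPdist_lt/(_ _ e2) : cB => nB.
have nU : nbhs x U by exact: open_nbhs_nbhs.
have /nbhs_ballP[r /= r0 rW] : nbhs x (U `&` ([set y | `|A x - A y| < e / 2]
    `&` [set y | `|B x - B y| < e / 2])).
  by apply: (filterI nU); exact: (filterI nA nB).
(* This size keeps the parallelogram spanned by d u and d v inside the ball of radius [r]; the
   summand 1 keeps the denominator positive when u = v = 0 and makes the inequality strict. *)
pose d := r / (`|u| + `|v| + 1).
have s0 : 0 < `|u| + `|v| + 1.
  by apply: ltr_wpDl; [apply: addr_ge0; exact: normr_ge0|exact: ltr01].
have d0 : 0 < d by exact: divr_gt0.
have dW s t : 0 <= s <= d -> 0 <= t <= d -> ball x r (x + s *: u + t *: v).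
  move=> /andP[s0' sd] /andP[t0 td].
  rewrite -ball_normE /= -addrA opprD addrA subrr sub0r normrN.
  apply: le_lt_trans (ler_normD _ _) _; rewrite !normrZ !ger0_norm//.
  have -> : r = d * (`|u| + `|v| + 1) by rewrite /d divfK// gt_eqF.
  rewrite mulrDr mulrDr mulr1 ltr_pwDr// lerD// ler_wpM2r//.
have [|s [t [sd td E1]]] := @second_difference n U f x u v d d0 sf.
  by move=> s t sd td; case: (rW _ (dW _ _ sd td)).
have [|t' [s' [td' sd' E2]]] := @second_difference n U f x v u d d0 sf.
  by move=> t' s' td' sd'; rewrite addrAC; case: (rW _ (dW _ _ sd' td')).
have [_ [_ Bst]] := rW _ (dW _ _ sd td).
have [_ [Ast _]] := rW _ (dW _ _ sd' td').
have E : A (x + s' *: u + t' *: v) = B (x + s *: u + t *: v).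
  have dn0 : d != 0 by rewrite gt_eqF.
  apply: (mulIf dn0); apply: (mulIf dn0).
  rewrite -[RHS]E1 [x + s' *: u + _]addrAC -[LHS]E2 [x + d *: v + _]addrAC.
  by ring.
have -> : 'D_u (fun y => 'D_v f y) x - 'D_v (fun y => 'D_u f y) x =
  (A x - A (x + s' *: u + t' *: v)) - (B x - B (x + s *: u + t *: v)).
  by rewrite E -[LHS]/(A x - B x) opprB addrA subrK.
rewrite (splitr e); apply: le_trans (ler_normB _ _) _.
apply: lerD; apply: ltW; [exact: Ast|exact: Bst].
Qed.

End Germs.

Lemma nbhs_open (T : topologicalType) (x : T) (S : set T) :
  nbhs x S -> exists V, [/\ open V, V x & V `<=` S].
Proof.
by move=> xS; exists S°; split; [exact: open_interior| |exact: interior_subset].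
Qed.

(** * Smoothness of a germ at a point *)

Section SmoothAt.
Variable R : realType.
Implicit Types n k : nat.

(** [smooth_near p f] unfolds to this predicate for the coordinate expression of [f] at the centre
    of [chart_at p]; here the point is free, so the same expression can be studied at neighbouring
    points. *)
Definition smooth_at n (f : 'rV[R]_n -> R) (x : 'rV[R]_n) : Prop :=
  exists U : set 'rV[R]_n, [/\ open U, U x & smooth_on U f].

Lemma Ck_on_pointwise n k (U : set 'rV[R]_n) f :
  (forall x, U x -> Ck_on k [set x] f) -> Ck_on k U f.
Proof.
elim: k f => [|k IH] f Uf; first by move=> x /Uf; apply.
split=> [x /Uf[+ _]|v]; first by apply.
by apply: IH => x /Uf[_]; apply.
Qed.

Lemma smooth_at_pointwise n (U : set 'rV[R]_n) f :
  (forall x, U x -> smooth_at f x) -> smooth_on U f.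
Proof.
move=> Uf k; apply: Ck_on_pointwise => x /Uf[V [_ Vx /(_ k)]].
by apply: sub_Ck_on => _ ->.
Qed.

Lemma smooth_on_at n (U : set 'rV[R]_n) f x :
  nbhs x U -> smooth_on U f -> smooth_at f x.
Proof.
move=> xU sf; exists U°; split; [exact: open_interior|exact: xU|move=> k].
by apply: sub_Ck_on (sf k); exact: interior_subset.
Qed.

Lemma smooth_at_near n (f : 'rV[R]_n -> R) x :
  smooth_at f x -> \forall y \near x, smooth_at f y.
Proof.
move=> [U [oU Ux sf]]; have xU : nbhs x U by exact: open_nbhs_nbhs.
by apply: filterS xU => y Uy; exists U.
Qed.

Lemma near_eq_smooth_at n (f g : 'rV[R]_n -> R) x :
  (\forall y \near x, f y = g y) -> smooth_at f x -> smooth_at g x.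
Proof.
move=> /near_join fg [U [oU Ux sf]]; have xU : nbhs x U by exact: open_nbhs_nbhs.
have [V [oV Vx VU]] := nbhs_open (filterI xU (nbhs_singleton fg)).
exists V; split => // k; apply: (@eq_Ck_on _ _ _ _ f) => //.
  by move=> y /VU[].
by apply: sub_Ck_on (sf k) => y /VU[].
Qed.

Lemma smooth_at_differentiable n (f : 'rV[R]_n -> R) x :
  smooth_at f x -> differentiable f x.
Proof. by move=> [U [_ Ux /smooth_on_differentiable]]; apply. Qed.

Lemma smooth_at_derive n (f : 'rV[R]_n -> R) x v :
  smooth_at f x -> smooth_at (fun y => 'D_v f y) x.
Proof.
by move=> [U [oU Ux sf]]; exists U; split => //; exact: smooth_on_derive.
Qed.

Lemma smooth_at_cst n (a : R) (x : 'rV[R]_n) : smooth_at (fun=> a) x.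
Proof. by exists setT; split; [exact: openT| |move=> k; exact: Ck_on_cst]. Qed.

Lemma smooth_at2 n (f g : 'rV[R]_n -> R) x : smooth_at f x -> smooth_at g x ->
  exists U, [/\ open U, U x, smooth_on U f & smooth_on U g].
Proof.
move=> [U [oU Ux sf]] [V [oV Vx sg]]; exists (U `&` V); split => //.
- exact: openI.
- by move=> k; apply: sub_Ck_on (sf k) => y [].
- by move=> k; apply: sub_Ck_on (sg k) => y [].
Qed.

Lemma smooth_atD n (f g : 'rV[R]_n -> R) x : smooth_at f x -> smooth_at g x ->
  smooth_at (fun y => f y + g y) x.
Proof.
move=> sf sg; have [U [oU Ux {}sf {}sg]] := smooth_at2 sf sg.
by exists U; split => // k; exact: Ck_onD.
Qed.

Lemma smooth_atM n (f g : 'rV[R]_n -> R) x : smooth_at f x -> smooth_at g x ->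
  smooth_at (fun y => f y * g y) x.
Proof.
move=> sf sg; have [U [oU Ux {}sf {}sg]] := smooth_at2 sf sg.
by exists U; split => // k; exact: Ck_onM.
Qed.

Lemma smooth_at_comp n n' (f : 'rV[R]_n' -> R) (G : 'rV[R]_n -> 'rV[R]_n') x :
  smooth_at f (G x) -> (forall j, smooth_at (fun y => G y 0 j) x) ->
  smooth_at (fun y => f (G y)) x.
Proof.
move=> sf sG.
have cG : {for x, continuous G}.
  apply: differentiable_continuous; apply: differentiable_rV => j.
  exact: smooth_at_differentiable.
have nf : \forall y \near x, smooth_at f (G y) by exact: cG (smooth_at_near sf).
have nG : \forall y \near x, forall j, smooth_at (fun y => G y 0 j) y.
  apply: (@filter_forall _ _ (fun j y => smooth_at (fun y => G y 0 j) y) (nbhs x)) => j.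
  exact: smooth_at_near.
have [U [oU Ux UG]] := nbhs_open (filterI nf nG).
exists U; split => //.
(* The target set consists of all points where [f] is smooth; only the source is shrunk, and
   finitely many components are smooth on a common neighbourhood. *)
apply: (@smooth_on_comp _ _ _ U [set z | smooth_at f z]) => //.
- by apply: smooth_at_pointwise.
- by move=> j; apply: smooth_at_pointwise => y /UG[].
- by move=> y /UG[].
Qed.

Lemma smooth_at_invsqrt n (f : 'rV[R]_n -> R) x :
  smooth_at f x -> 0 < f x -> smooth_at (fun y => (Num.sqrt (f y))^-1) x.
Proof.
move=> sf f0.
have cf : {for x, continuous f}.
  by apply: differentiable_continuous; exact: smooth_at_differentiable.
have nf : \forall y \near x, 0 < f y by exact: (@cvgr_gt _ _ (nbhs x) _ f (f x) cf 0 f0).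
have [U [oU Ux Uf]] := nbhs_open (filterI (smooth_at_near sf) nf).
exists U; split => //; apply: smooth_on_invsqrt => //; last by move=> y /Uf[].
by apply: smooth_at_pointwise => y /Uf[].
Qed.

Lemma smooth_at_Schwarz n (f : 'rV[R]_n -> R) x u v : smooth_at f x ->
  'D_u (fun y => 'D_v f y) x = 'D_v (fun y => 'D_u f y) x.
Proof. by move=> [U [oU Ux sf]]; exact: Schwarz sf Ux. Qed.

End SmoothAt.

(** * Coordinates on a manifold *)

Section Charts.
Variables (R : realType) (n : nat).

Lemma near_cinv (T : topologicalType) (C : chart R n T) (q : T) (P : T -> Prop) :
  cdom C q -> (\forall r \near q, P r) -> \forall x \near C q, P (cinv C x).
Proof.
move=> Cq nP; have cC : {for C q, continuous (cinv C)}.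
  by apply: cinv_continuous; exists q.
by apply: cC; rewrite cmapK.
Qed.

Lemma near_cmap (T : topologicalType) (C : chart R n T) (q : T) (P : 'rV[R]_n -> Prop) :
  cdom C q -> (\forall x \near C q, P x) -> \forall r \near q, P (C r).
Proof. by move=> Cq nP; exact: (cmap_continuous Cq). Qed.

Lemma near_cdom (T : topologicalType) (C : chart R n T) (q : T) :
  cdom C q -> \forall r \near q, cdom C r.
Proof. by move=> Cq; apply: open_nbhs_nbhs; split => //; exact: cdom_open. Qed.

Lemma near_cinvK (T : topologicalType) (C : chart R n T) (q : T) :
  cdom C q -> \forall x \near C q, C (cinv C x) = x.
Proof.
move=> Cq; have : nbhs (C q) (C @` cdom C).
  by apply: open_nbhs_nbhs; split; [exact: ccod_open|exists q].
by apply: filterS => _ [r Cr <-]; rewrite cmapK.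
Qed.

Lemma near_chart (T : topologicalType) (C : chart R n T) (q : T) (P : T -> Prop) :
  cdom C q -> (\forall x \near C q, P (cinv C x)) -> \forall r \near q, P r.
Proof.
move=> Cq /(near_cmap Cq) nP.
apply: filterS (filterI (near_cdom Cq) nP) => r [Cr].
by rewrite /= cmapK.
Qed.

Variable N : manifold R n.
Implicit Types (p q r a b c : N) (f g : N -> R) (X Y : N -> 'rV[R]_n).

(** [smooth_near q] always reads in [chart_at q], which changes with [q]; here the chart stays that
    of [p] while [q] moves. *)
Definition smooth_in p f q : Prop :=
  smooth_at (fun x => f (cinv (chart_at p) x)) (chart_at p q).

Lemma transition_smooth_at a b r j : cdom (chart_at a) r -> cdom (chart_at b) r ->
  smooth_at (fun x => chart_at a (cinv (chart_at b) x) 0 j) (chart_at b r).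
Proof.
move=> ar br; apply: smooth_on_at (@transition_smooth _ _ N b a j).
apply: filterS (filterI (near_cinvK br) (near_cinv br
  (filterI (near_cdom br) (near_cdom ar)))) => x [xK [bx ax]].
by exists (cinv (chart_at b) x).
Qed.

Lemma transition_differentiable a b r :
  cdom (chart_at a) r -> cdom (chart_at b) r ->
  differentiable (fun x => chart_at a (cinv (chart_at b) x)) (chart_at b r).
Proof.
move=> ar br; apply: differentiable_rV => j.
exact/smooth_at_differentiable/transition_smooth_at.
Qed.

Lemma smooth_in_change a b f r : cdom (chart_at a) r -> cdom (chart_at b) r ->
  smooth_in a f r -> smooth_in b f r.
Proof.
move=> ar br sf.
apply: (@near_eq_smooth_at _ _ (fun x => f (cinv (chart_at a)
   (chart_at a (cinv (chart_at b) x))))).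
  by apply: filterS (near_cinv br (near_cdom ar)) => x ax; rewrite cmapK.
apply: (@smooth_at_comp _ _ _ (fun y => f (cinv (chart_at a) y))
   (fun x => chart_at a (cinv (chart_at b) x))).
  by rewrite cmapK.
by move=> j; exact: transition_smooth_at.
Qed.

Lemma smooth_in_near a f r : cdom (chart_at a) r -> smooth_in a f r ->
  \forall q \near r, smooth_in a f q.
Proof.
move=> ar /smooth_at_near sf; apply: filterS (near_cmap ar sf) => q; exact.
Qed.

Lemma smooth_in_smooth_near p q f : cdom (chart_at p) q -> smooth_in p f q -> smooth_near q f.
Proof. by move=> pq; exact: (@smooth_in_change p q f q pq (chart_at_dom q)). Qed.

Lemma near_eq_smooth_in p q f g : cdom (chart_at p) q ->
  (\forall r \near q, f r = g r) -> smooth_in p f q -> smooth_in p g q.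
Proof. by move=> pq fg; apply: near_eq_smooth_at; exact: (near_cinv pq fg). Qed.

Lemma near_eq_smooth_near p f g :
  (\forall r \near p, f r = g r) -> smooth_near p f -> smooth_near p g.
Proof. exact: (near_eq_smooth_in (chart_at_dom p)). Qed.

(* The Jacobian of the change of coordinates from [chart_at b] to [chart_at a]:
   both [tcoord] and [cst_field] are instances of it. *)
Definition jac a b r (w : 'rV[R]_n) : 'rV[R]_n :=
  'D_w (fun x => chart_at a (cinv (chart_at b) x)) (chart_at b r).

(** The chain rule through the transition map. It gives the change of coordinates for differentials
    of functions and, when [F] is itself a chart, the cocycle rule for Jacobians. *)
Lemma derive_chart (W : normedModType R) (F : N -> W) a b r w :
  cdom (chart_at a) r -> cdom (chart_at b) r ->
  differentiable (fun x => F (cinv (chart_at a) x)) (chart_at a r) ->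
  'D_w (fun x => F (cinv (chart_at b) x)) (chart_at b r) =
  'D_(jac a b r w) (fun x => F (cinv (chart_at a) x)) (chart_at a r).
Proof.
move=> ar br dF.
have dF' : differentiable (fun x => F (cinv (chart_at a) x))
    (chart_at a (cinv (chart_at b) (chart_at b r))) by rewrite cmapK.
have := @derive_compose _ _ _ _ (fun x => F (cinv (chart_at a) x))
  (fun x => chart_at a (cinv (chart_at b) x)) (chart_at b r) w
  (transition_differentiable ar br) dF'.
rewrite cmapK// => <-; apply: near_eq_derive.
by apply: filterS (near_cinv br (near_cdom ar)) => x ax /=; rewrite cmapK.
Qed.

Lemma jac_comp a b c r w : cdom (chart_at a) r -> cdom (chart_at b) r ->
  cdom (chart_at c) r -> jac a b r (jac b c r w) = jac a c r w.
Proof.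
by move=> ar br cr; rewrite [RHS](@derive_chart _ (chart_at a : N -> 'rV[R]_n) b)//;
  exact: transition_differentiable.
Qed.

Lemma jac_id a r w : cdom (chart_at a) r -> jac a a r w = w.
Proof.
move=> ar; rewrite -[RHS](@derive_id _ _ (chart_at a r) w).
by apply: near_eq_derive; exact: near_cinvK.
Qed.

Lemma jac_linear a b r (k : R) u v : cdom (chart_at a) r -> cdom (chart_at b) r ->
  jac a b r (k *: u + v) = k *: jac a b r u + jac a b r v.
Proof. by move=> ar br; apply: derive_linear; exact: transition_differentiable. Qed.

Lemma tcoord_cst_field p q v : cdom (chart_at p) q -> tcoord p q (cst_field p v q) = v.
Proof.
move=> pq; have qq := chart_at_dom q.
by rewrite -[LHS]/(jac p q q (jac q p q v)) jac_comp// jac_id.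
Qed.

Lemma cst_field_tcoord p q w : cdom (chart_at p) q -> cst_field p (tcoord p q w) q = w.
Proof.
move=> pq; have qq := chart_at_dom q.
by rewrite -[LHS]/(jac q p q (jac p q q w)) jac_comp// jac_id.
Qed.

Lemma tcoord_id p w : tcoord p p w = w.
Proof. by apply: jac_id; exact: chart_at_dom. Qed.

Lemma cst_field_id p w : cst_field p w p = w.
Proof. by apply: jac_id; exact: chart_at_dom. Qed.

Lemma tcoord_linear p q (k : R) u v : cdom (chart_at p) q ->
  tcoord p q (k *: u + v) = k *: tcoord p q u + tcoord p q v.
Proof. by move=> pq; apply: jac_linear => //; exact: chart_at_dom. Qed.

Lemma fdiff_chart p q f w : cdom (chart_at p) q ->
  differentiable (fun x => f (cinv (chart_at p) x)) (chart_at p q) ->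
  fdiff f q w = 'D_(tcoord p q w) (fun x => f (cinv (chart_at p) x)) (chart_at p q).
Proof. by move=> pq df; apply: derive_chart => //; exact: chart_at_dom. Qed.

End Charts.

(** * Bilinearity of the inner product *)

Section InnerProduct.
Variables (R : realType) (n : nat) (T : Type) (h : T -> 'M[R]_n) (p : T).
Implicit Types u v w : 'rV[R]_n.

Lemma ipDl u v w : ip h p (u + v) w = ip h p u w + ip h p v w.
Proof. by rewrite /ip !mulmxDl mxE. Qed.

Lemma ipZl (a : R) u w : ip h p (a *: u) w = a * ip h p u w.
Proof. by rewrite /ip -!scalemxAl mxE. Qed.

Lemma ipDr u v w : ip h p w (u + v) = ip h p w u + ip h p w v.
Proof. by rewrite /ip linearD /= mulmxDr mxE. Qed.

Lemma ipZr (a : R) u w : ip h p w (a *: u) = a * ip h p w u.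
Proof. by rewrite /ip linearZ /= -scalemxAr mxE. Qed.

Lemma ip0l w : ip h p 0 w = 0.
Proof. by rewrite -(scale0r 0) ipZl mul0r. Qed.

Lemma ip0r w : ip h p w 0 = 0.
Proof. by rewrite -(scale0r 0) ipZr mul0r. Qed.

Lemma ipBl u v w : ip h p (u - v) w = ip h p u w - ip h p v w.
Proof. by rewrite -scaleN1r ipDl ipZl mulN1r. Qed.

Lemma ipBr u v w : ip h p w (u - v) = ip h p w u - ip h p w v.
Proof. by rewrite -scaleN1r ipDr ipZr mulN1r. Qed.

Lemma ip_suml (I : Type) (r : seq I) (F : I -> 'rV[R]_n) w :
  ip h p (\sum_(i <- r) F i) w = \sum_(i <- r) ip h p (F i) w.
Proof. by elim: r => [|i r IH]; rewrite ?big_nil ?ip0l// !big_cons ipDl IH. Qed.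

Lemma ip_sumr (I : Type) (r : seq I) (F : I -> 'rV[R]_n) w :
  ip h p w (\sum_(i <- r) F i) = \sum_(i <- r) ip h p w (F i).
Proof. by elim: r => [|i r IH]; rewrite ?big_nil ?ip0r// !big_cons ipDr IH. Qed.

End InnerProduct.

Lemma smooth_at_sum (R : realType) n (I : Type) (r : seq I)
    (F : I -> 'rV[R]_n -> R) x :
  (forall i, smooth_at (F i) x) -> smooth_at (fun y => \sum_(i <- r) F i y) x.
Proof.
move=> sF; elim: r => [|i r IH].
  have -> : (fun y => \sum_(i <- [::]) F i y) = (fun=> 0).
    by apply/funext => y; rewrite big_nil.
  exact: smooth_at_cst.
have -> : (fun y => \sum_(j <- i :: r) F j y) =
    (fun y => F i y + \sum_(j <- r) F j y).
  by apply/funext => y; rewrite big_cons.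
exact: smooth_atD.
Qed.

(** * Smooth functions and vector fields near a point *)

Section Fields.
Variables (R : realType) (n : nat) (N : manifold R n).
Implicit Types (p q : N) (f g : N -> R) (X Y Z W : N -> 'rV[R]_n) (u v w : 'rV[R]_n).

Lemma smooth_near_cst p (k : R) : smooth_near p (fun=> k).
Proof. exact: smooth_at_cst. Qed.

Lemma smooth_nearD p f g : smooth_near p f -> smooth_near p g ->
  smooth_near p (fun q => f q + g q).
Proof. exact: smooth_atD. Qed.

Lemma smooth_nearM p f g : smooth_near p f -> smooth_near p g ->
  smooth_near p (fun q => f q * g q).
Proof. exact: smooth_atM. Qed.

Lemma smooth_near_sum p (I : Type) (r : seq I) (F : I -> N -> R) :
  (forall i, smooth_near p (F i)) -> smooth_near p (fun q => \sum_(i <- r) F i q).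
Proof.
by move=> sF; exact: smooth_at_sum.
Qed.

Lemma near_eq_fdiff p f g v :
  (\forall q \near p, f q = g q) -> fdiff f p v = fdiff g p v.
Proof. by move=> fg; apply: near_eq_derive; exact: near_cinv (chart_at_dom p) fg. Qed.

Lemma smooth_near_differentiable p f : smooth_near p f ->
  differentiable (fun x => f (cinv (chart_at p) x)) (chart_at p p).
Proof. by move/smooth_at_differentiable. Qed.

Lemma smooth_near_derivable p f v : smooth_near p f ->
  derivable (fun x => f (cinv (chart_at p) x)) (chart_at p p) v.
Proof. by move/smooth_near_differentiable/diff_derivable. Qed.

Lemma fdiff_cst p k v : fdiff (fun=> k) p v = 0.
Proof. exact: derive_cst. Qed.

Lemma fdiffD p f g v : smooth_near p f -> smooth_near p g ->
  fdiff (fun q => f q + g q) p v = fdiff f p v + fdiff g p v.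
Proof. by move=> sf sg; apply: deriveD; exact: smooth_near_derivable. Qed.

Lemma fdiffM p f g v : smooth_near p f -> smooth_near p g ->
  fdiff (fun q => f q * g q) p v = f p * fdiff g p v + g p * fdiff f p v.
Proof.
move=> sf sg; have pp := chart_at_dom p.
have := deriveM (@smooth_near_derivable p f v sf) (@smooth_near_derivable p g v sg).
by rewrite !cmapK.
Qed.

Lemma fdiff_sum p (I : Type) (r : seq I) (F : I -> N -> R) v :
  (forall i, smooth_near p (F i)) ->
  fdiff (fun q => \sum_(i <- r) F i q) p v = \sum_(i <- r) fdiff (F i) p v.
Proof.
move=> sF; elim: r => [|i r IH].
  rewrite big_nil -[RHS](fdiff_cst p 0 v).
  by apply: near_eq_fdiff; apply: nearW => q; rewrite big_nil.
rewrite big_cons -IH -(fdiffD v (sF i) (smooth_near_sum r sF)).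
by apply: near_eq_fdiff; apply: nearW => q; rewrite big_cons.
Qed.

Lemma fdiff_linear p f (k : R) u v : smooth_near p f ->
  fdiff f p (k *: u + v) = k * fdiff f p u + fdiff f p v.
Proof. by move/smooth_near_differentiable => df; exact: derive_linear. Qed.

Lemma tcoordZ p q (k : R) u : cdom (chart_at p) q ->
  tcoord p q (k *: u) = k *: tcoord p q u.
Proof.
move=> pq; have z : tcoord p q 0 = 0 by exact: derive0.
by have := tcoord_linear k u 0 pq; rewrite z !addr0.
Qed.

Lemma tcoordD p q u v : cdom (chart_at p) q ->
  tcoord p q (u + v) = tcoord p q u + tcoord p q v.
Proof. by move=> pq; have := tcoord_linear 1 u v pq; rewrite !scale1r. Qed.

Lemma cst_field_sum_delta p q u : cdom (chart_at p) q ->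
  cst_field p u q = \sum_(j < n) u 0 j *: cst_field p (delta_mx 0 j) q.
Proof.
move=> pq; apply: derive_sum_dir; apply: transition_differentiable => //.
exact: chart_at_dom.
Qed.

Lemma near_dom p : \forall q \near p, cdom (chart_at p) q.
Proof. exact/near_cdom/chart_at_dom. Qed.

Lemma near_eq_vfield_smooth p X Y : (\forall q \near p, X q = Y q) ->
  vfield_smooth_near p X -> vfield_smooth_near p Y.
Proof.
move=> XY sX j; apply: near_eq_smooth_near (sX j).
by apply: filterS XY => q ->.
Qed.

Lemma vfield_smooth_cst p v : vfield_smooth_near p (cst_field p v).
Proof.
move=> j; apply: near_eq_smooth_near (smooth_near_cst p (v 0 j)).
by apply: filterS (near_dom p) => q pq; rewrite tcoord_cst_field.
Qed.

Lemma vfield_smoothD p X Y : vfield_smooth_near p X -> vfield_smooth_near p Y ->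
  vfield_smooth_near p (fun q => X q + Y q).
Proof.
move=> sX sY j; apply: near_eq_smooth_near (smooth_nearD (sX j) (sY j)).
by apply: filterS (near_dom p) => q pq; rewrite tcoordD// mxE.
Qed.

Lemma vfield_smoothZ p f X : smooth_near p f -> vfield_smooth_near p X ->
  vfield_smooth_near p (fun q => f q *: X q).
Proof.
move=> sf sX j; apply: near_eq_smooth_near (smooth_nearM sf (sX j)).
by apply: filterS (near_dom p) => q pq; rewrite tcoordZ// mxE.
Qed.

Lemma vfield_smooth0 p : vfield_smooth_near p (fun=> 0).
Proof.
move=> j; apply: near_eq_smooth_near (smooth_near_cst p 0).
by apply: nearW => q; rewrite /tcoord derive0 mxE.
Qed.

Lemma vfield_smooth_sum p (I : Type) (r : seq I) (F : I -> N -> 'rV[R]_n) :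
  (forall i, vfield_smooth_near p (F i)) ->
  vfield_smooth_near p (fun q => \sum_(i <- r) F i q).
Proof.
move=> sF; elim: r => [|i r IH].
  apply: near_eq_vfield_smooth (vfield_smooth0 p).
  by apply: nearW => q; rewrite big_nil.
apply: near_eq_vfield_smooth (vfield_smoothD (sF i) IH).
by apply: nearW => q; rewrite big_cons.
Qed.

Lemma vfield_expand p q X : cdom (chart_at p) q ->
  X q = \sum_(j < n) tcoord p q (X q) 0 j *: cst_field p (delta_mx 0 j) q.
Proof. by move=> pq; rewrite -cst_field_sum_delta// cst_field_tcoord. Qed.

(** The Jacobian is taken at a moving point, but in the chart around [p] its entry is a directional
    derivative of one fixed transition function. The explicit formula is kept because it turns
    brackets of coordinate fields into second derivatives. *)
Lemma jac_coord_smooth p q j v : cdom (chart_at p) q ->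
  smooth_in p (fun r => jac q p r v 0 j) q /\
  (\forall x \near chart_at p q, jac q p (cinv (chart_at p) x) v 0 j =
    'D_v (fun y => chart_at q (cinv (chart_at p) y) 0 j) x).
Proof.
move=> pq; have qq := chart_at_dom q.
have E : \forall x \near chart_at p q, jac q p (cinv (chart_at p) x) v 0 j =
    'D_v (fun y => chart_at q (cinv (chart_at p) y) 0 j) x.
  apply: filterS (filterI (near_cinvK pq) (near_cinv pq
    (filterI (near_cdom pq) (near_cdom qq)))) => x [xK [px qx]].
  rewrite /jac derive_coord ?xK//; rewrite -xK; exact: transition_differentiable.
split => //; apply: near_eq_smooth_at (smooth_at_derive v
  (@transition_smooth_at _ _ N q p q j qq pq)).
by apply: filterS E => x ->.
Qed.

(** At [q] the components must be read in [chart_at q]; they arise from those in [chart_at p] by a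
    Jacobian with smooth entries. This allows the rules of a connection to be used at all points
    near [p], hence to be differentiated. *)
Lemma vfield_smooth_near_near p X : vfield_smooth_near p X ->
  \forall q \near p, vfield_smooth_near q X.
Proof.
move=> sX; have pp := chart_at_dom p.
have nX : \forall q \near p, forall j, smooth_in p (fun r => tcoord p r (X r) 0 j) q.
  apply: (@filter_forall _ _
    (fun j q => smooth_in p (fun r => tcoord p r (X r) 0 j) q) (nbhs p)) => j.
  exact: (smooth_in_near pp (sX j)).
apply: filterS (filterI (near_dom p) nX) => q [pq sXq] i.
have qq := chart_at_dom q.
apply: (smooth_in_smooth_near pq).
apply: (@near_eq_smooth_in _ _ _ p q (fun r => \sum_(j < n)
  tcoord p r (X r) 0 j * jac q p r (delta_mx 0 j) 0 i)) => //.
  apply: filterS (filterI (near_cdom pq) (near_cdom qq)) => r [pr qr].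
  rewrite -[RHS]/(jac q r r (X r) 0 i) -(jac_comp _ qr pr)//; last exact: chart_at_dom.
  rewrite [in RHS]/jac derive_sum_dir; last exact: transition_differentiable.
  by rewrite summxE; apply: eq_bigr => j _; rewrite mxE.
have s j : smooth_in p (fun r => tcoord p r (X r) 0 j *
    jac q p r (delta_mx 0 j) 0 i) q.
  apply: smooth_atM; first exact: sXq.
  by have [] := jac_coord_smooth i (delta_mx 0 j) pq.
exact: smooth_at_sum.
Qed.

(** Read in [chart_at q], both terms of a component are mixed second derivatives of the same
    transition function. The point [q] ranges over the chart domain because the resulting symmetry
    of the connection is itself differentiated in the Bianchi identity. *)
Lemma lie_bracket_cst p q u v : cdom (chart_at p) q ->
  lie_bracket (cst_field p u) (cst_field p v) q = 0.
Proof.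
move=> pq; have qq := chart_at_dom q; apply/rowP => j; rewrite !mxE.
have E (a b : 'rV[R]_n) :
    fdiff (fun r => tcoord q r (cst_field p b r) 0 j) q (cst_field p a q) =
    'D_a (fun x => 'D_b (fun y => chart_at q (cinv (chart_at p) y) 0 j) x) (chart_at p q).
  have [sj ej] := jac_coord_smooth j b pq.
  rewrite (@near_eq_fdiff _ _ (fun r => jac q p r b 0 j)); last first.
    apply: filterS (filterI (near_cdom pq) (near_cdom qq)) => r [pr qr].
    rewrite -(@jac_comp _ _ N q r p)//; exact: chart_at_dom.
  rewrite (fdiff_chart _ pq) ?tcoord_cst_field//; last exact: smooth_at_differentiable.
  exact: near_eq_derive.
have S := smooth_at_Schwarz u v (@transition_smooth_at _ _ N q p q j qq pq).
apply: etrans (congr2 (fun a b => a - b) (E u v) (E v u)) _.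
by move: S => /= ->; exact: subrr.
Qed.

End Fields.

(** * Nondegeneracy and smoothness of the metric *)

Section Metric.
Variables (R : realType) (n : nat) (N : manifold R n) (h : N -> 'M[R]_n).
Hypothesis hM : riemannian_metric h.
Implicit Types (p q : N) (X Y : N -> 'rV[R]_n) (u v w : 'rV[R]_n).

Lemma ip_eq p u v : (forall w, ip h p u w = ip h p v w) -> u = v.
Proof.
move=> uv; apply/eqP; rewrite -subr_eq0; apply/negPn/negP => d0.
by have := metric_pos hM p d0; rewrite ipBl uv subrr ltxx.
Qed.

Lemma smooth_ip p X Y : vfield_smooth_near p X -> vfield_smooth_near p Y ->
  smooth_near p (fun q => ip h q (X q) (Y q)).
Proof.
move=> sX sY.
apply: (@near_eq_smooth_near _ _ _ _ (fun q => \sum_(i < n) \sum_(j < n)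
   (tcoord p q (X q) 0 i * tcoord p q (Y q) 0 j *
    ip h q (cst_field p (delta_mx 0 i) q) (cst_field p (delta_mx 0 j) q)))).
  apply: filterS (near_dom p) => q pq.
  rewrite [in RHS](vfield_expand X pq) [in RHS](vfield_expand Y pq) ip_suml.
  apply: eq_bigr => i _; rewrite ipZl ip_sumr mulr_sumr.
  by apply: eq_bigr => j _; rewrite ipZr mulrA.
apply: smooth_near_sum => i; apply: smooth_near_sum => j.
apply: smooth_nearM; first by apply: smooth_nearM; [exact: sX|exact: sY].
exact: metric_smooth.
Qed.

End Metric.

(** The octahedron argument: the Bianchi identities of the four cyclic rotations of a, b, c, d,
    brought by the skew symmetries to the same few values, form a linear system that gives the
    claim. *)
Lemma pair_symmetry (R : realType) (V : Type) (r : V -> V -> V -> V -> R) :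
  (forall a b c d, r a b c d = - r b a c d) ->
  (forall a b c d, r a b c d = - r a b d c) ->
  (forall a b c d, r a b c d + r b c a d + r c a b d = 0) ->
  forall a b c d, r a b c d = r c d a b.
Proof.
move=> r12 r34 rB a b c d.
have := rB a b c d; have := rB b c d a; have := rB c d a b; have := rB d a b c.
rewrite (r34 b c d a) (r34 c d b a) (r12 d b c a) (r12 d a c b) (r34 a d c b).
rewrite (r12 a c d b) (r34 c a d b) (r12 d a b c) (r34 a b d c) (r34 b d a c).
by lra.
Qed.

(** * Connections and curvature *)

Section Connection.
Variables (R : realType) (n : nat) (N : manifold R n).
Variable nabla : (N -> 'rV[R]_n) -> N -> 'rV[R]_n -> 'rV[R]_n.
Implicit Types (p q : N) (f : N -> R) (X Y Z W : N -> 'rV[R]_n) (u v w z : 'rV[R]_n).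

Section Affine.
Hypothesis nA : affine_connection nabla.

(* The indicator function [g] of the agreement set is locally constant, and
   [g X = g Y] everywhere: Leibniz' rule then makes [nabla] a local operator. *)
Lemma nabla_local p X Y v : vfield_smooth_near p X ->
  (\forall q \near p, X q = Y q) -> nabla X p v = nabla Y p v.
Proof.
move=> sX XY; have sY := near_eq_vfield_smooth XY sX.
pose g q : R := `[< X q = Y q >]%:R.
have g1 : \forall q \near p, 1 = g q.
  by apply: filterS XY => q Xq; rewrite /g asboolT.
have sg : smooth_near p g := near_eq_smooth_near g1 (smooth_near_cst p 1).
have gp : g p = 1 by rewrite -(nbhs_singleton g1).
have dg : fdiff g p v = 0 by rewrite -(near_eq_fdiff v g1) fdiff_cst.
have := nabla_leibniz nA sg sX v; have := nabla_leibniz nA sg sY v.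
rewrite gp dg !scale0r !add0r !scale1r => <- <-.
congr (nabla _ _ _); apply/funext => q; rewrite /g.
by case: asboolP => [->//|_]; rewrite !scale0r.
Qed.

Lemma nabla_dirD p X u v : vfield_smooth_near p X ->
  nabla X p (u + v) = nabla X p u + nabla X p v.
Proof. by move=> sX; have := nabla_linear nA sX 1 u v; rewrite !scale1r. Qed.

Lemma nabla_dir0 p X : vfield_smooth_near p X -> nabla X p 0 = 0.
Proof.
move=> sX; have := nabla_linear nA sX (-1) 0 0.
by rewrite scaler0 addr0 scaleN1r addNr.
Qed.

Lemma nabla_dirZ p X (k : R) u : vfield_smooth_near p X ->
  nabla X p (k *: u) = k *: nabla X p u.
Proof.
by move=> sX; have := nabla_linear nA sX k u 0; rewrite (nabla_dir0 sX) !addr0.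
Qed.

Lemma nabla_dir_sum p X (I : Type) (r : seq I) (F : I -> 'rV[R]_n) :
  vfield_smooth_near p X ->
  nabla X p (\sum_(i <- r) F i) = \sum_(i <- r) nabla X p (F i).
Proof.
move=> sX; elim: r => [|i r IH]; first by rewrite !big_nil nabla_dir0.
by rewrite !big_cons nabla_dirD// IH.
Qed.

Lemma nabla0 p v : nabla (fun=> 0) p v = 0.
Proof.
have := nabla_leibniz nA (smooth_near_cst p 0) (vfield_smooth0 p) v.
by rewrite fdiff_cst !scale0r addr0.
Qed.

Lemma nabla_sum p (I : Type) (r : seq I) (F : I -> N -> 'rV[R]_n) v :
  (forall i, vfield_smooth_near p (F i)) ->
  nabla (fun q => \sum_(i <- r) F i q) p v = \sum_(i <- r) nabla (F i) p v.
Proof.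
move=> sF; elim: r => [|i r IH].
  rewrite big_nil -[RHS](nabla0 p v); congr (nabla _ _ _).
  by apply/funext => q; rewrite big_nil.
rewrite big_cons -IH -(nabla_add nA (sF i) (vfield_smooth_sum r sF)).
by congr (nabla _ _ _); apply/funext => q; rewrite big_cons.
Qed.

(** Locality and the Leibniz rule, applied to the coordinate expansion of [X]. The result has the
    shape of the definition of [pullback_connection], with which [pullback_comp] compares it. *)
Lemma nabla_expand p X v : vfield_smooth_near p X ->
  nabla X p v = \sum_(j < n)
    (fdiff (fun q => tcoord p q (X q) 0 j) p v *: delta_mx 0 j
     + X p 0 j *: nabla (cst_field p (delta_mx 0 j)) p v).
Proof.
move=> sX.
have sF j : vfield_smooth_near p
    (fun q => tcoord p q (X q) 0 j *: cst_field p (delta_mx 0 j) q).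
  by apply: vfield_smoothZ; [exact: sX|exact: vfield_smooth_cst].
have E : \forall q \near p, X q = \sum_(j < n)
    tcoord p q (X q) 0 j *: cst_field p (delta_mx 0 j) q.
  by apply: filterS (near_dom p) => q pq; exact: vfield_expand.
rewrite (nabla_local v sX E) (nabla_sum _ v sF); apply: eq_bigr => j _.
rewrite (nabla_leibniz nA (sX j) (vfield_smooth_cst p _)).
by rewrite cst_field_id tcoord_id.
Qed.

End Affine.

(** * Symmetries of the curvature of a Levi-Civita connection *)

Section LeviCivita.
Variable h : N -> 'M[R]_n.
Hypotheses (hM : riemannian_metric h) (nLC : levi_civita h nabla).
Let nA := lc_connection nLC.

(* No bracket term: the coordinate fields of one chart commute. *)
Definition cst_curvature p u v Z : 'rV[R]_n :=
  nabla (fun q => nabla Z q (cst_field p v q)) p u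
  - nabla (fun q => nabla Z q (cst_field p u q)) p v.

Lemma curvature_at_cst p u v w :
  curvature_at nabla p u v w = cst_curvature p u v (cst_field p w).
Proof.
rewrite /curvature_at /curvature lie_bracket_cst; last exact: chart_at_dom.
by rewrite (nabla_dir0 nA (vfield_smooth_cst p w)) subr0 !cst_field_id.
Qed.

Lemma cst_curvatureC p u v Z : cst_curvature p u v Z = - cst_curvature p v u Z.
Proof. by rewrite /cst_curvature opprB. Qed.

Lemma nabla_cst_sym p q u v : cdom (chart_at p) q ->
  vfield_smooth_near q (cst_field p u) -> vfield_smooth_near q (cst_field p v) ->
  nabla (cst_field p v) q (cst_field p u q) = nabla (cst_field p u) q (cst_field p v q).
Proof.
move=> pq su sv; apply/eqP; rewrite -subr_eq0 (lc_torsion_free nLC su sv).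
by rewrite lie_bracket_cst.
Qed.

Lemma nabla_cst_sym_near p u v : \forall q \near p,
  nabla (cst_field p v) q (cst_field p u q) = nabla (cst_field p u) q (cst_field p v q).
Proof.
apply: filterS (filterI (near_dom p) (filterI
  (vfield_smooth_near_near (vfield_smooth_cst p u))
  (vfield_smooth_near_near (vfield_smooth_cst p v)))) => q [pq [su sv]].
exact: nabla_cst_sym.
Qed.

(** Torsion-freeness, valid on a neighbourhood and hence under a further derivative, makes [D]
    symmetric in its first two slots; the six terms of the cyclic sum then cancel in pairs. *)
Lemma Bianchi p u v w :
  cst_curvature p u v (cst_field p w) + cst_curvature p v w (cst_field p u)
  + cst_curvature p w u (cst_field p v) = 0.
Proof.
pose D a b c := nabla (fun q => nabla (cst_field p a) q (cst_field p b q)) p c.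
have E a b c : D a b c = D b a c.
  apply: (nabla_local nA); last exact: nabla_cst_sym_near.
  by apply: (nabla_smooth nA); exact: vfield_smooth_cst.
suff: D w v u - D w u v + (D u w v - D u v w) + (D v u w - D v w u) = 0 by [].
move: D E => D E; rewrite (E w v u) (E u w v) (E v u w).
move: (D v w u) (D u w v) (D v u w) => a b c.
by apply/rowP => i; rewrite !mxE; ring.
Qed.

(** Second derivatives of <Z, W> commute, and the cross terms <nabla Z, nabla W> are symmetric in
    the two directions, so the commutator keeps only curvature terms. The fields are general so that
    [Z] can be [xi]; the right-hand side involves [Z] only through its value at [p]. *)
Lemma cst_curvature_skew p u v Z W :
  vfield_smooth_near p Z -> vfield_smooth_near p W ->
  ip h p (cst_curvature p u v Z) (W p) = - ip h p (Z p) (cst_curvature p u v W).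
Proof.
move=> sZ sW; pose G q := ip h q (Z q) (W q).
have sG : smooth_near p G := smooth_ip hM sZ sW.
have pp := chart_at_dom p.
have D2 a b : 'D_a (fun x => 'D_b (fun y => G (cinv (chart_at p) y)) x) (chart_at p p) =
    ip h p (nabla (fun q => nabla Z q (cst_field p b q)) p a) (W p)
    + ip h p (nabla Z p b) (nabla W p a) + (ip h p (nabla Z p a) (nabla W p b)
    + ip h p (Z p) (nabla (fun q => nabla W q (cst_field p b q)) p a)).
  have sb := vfield_smooth_cst p b.
  have sZb : vfield_smooth_near p (fun q => nabla Z q (cst_field p b q)).
    exact: (nabla_smooth nA).
  have sWb : vfield_smooth_near p (fun q => nabla W q (cst_field p b q)).
    exact: (nabla_smooth nA).
  have L1 := lc_metric nLC sZb sW a; have L2 := lc_metric nLC sZ sWb a.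
  rewrite cst_field_id in L1; rewrite cst_field_id in L2.
  apply: etrans (congr2 +%R L1 L2).
  apply: etrans (fdiffD a (smooth_ip hM sZb sW) (smooth_ip hM sZ sWb)).
  apply: near_eq_derive.
  (* The outer derivative sees the germ of the inner one, so metric compatibility is needed at every
     point near the centre of the chart. *)
  have nsG : \forall x \near chart_at p p,
     smooth_at (fun y => G (cinv (chart_at p) y)) x by exact: smooth_at_near.
  have nf : \forall q \near p, cdom (chart_at p) q /\
    (vfield_smooth_near q Z /\ vfield_smooth_near q W).
    exact: (filterI (near_dom p) (filterI (vfield_smooth_near_near sZ)
      (vfield_smooth_near_near sW))).
  apply: filterS (filterI nsG (filterI (near_cinvK pp) (near_cinv pp nf))).
  move=> x [sGx [xK [px [sZx sWx]]]] /=.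
  have dG : differentiable (fun y => G (cinv (chart_at p) y))
      (chart_at p (cinv (chart_at p) x)).
    by rewrite xK; exact: smooth_at_differentiable.
  apply: etrans (lc_metric nLC sZx sWx _); apply/esym.
  apply: etrans (fdiff_chart _ px dG) _.
  by rewrite tcoord_cst_field// xK.
have := smooth_at_Schwarz u v sG; rewrite !D2 /cst_curvature ipBl ipBr => S.
by lra.
Qed.

Lemma cst_curvature_pair p u v w z :
  ip h p (cst_curvature p u v (cst_field p w)) z =
  ip h p (cst_curvature p w z (cst_field p u)) v.
Proof.
pose r a b c d := ip h p (cst_curvature p a b (cst_field p c)) d.
have r12 a b c d : r a b c d = - r b a c d.
  by rewrite /r cst_curvatureC -scaleN1r ipZl mulN1r.
have r34 a b c d : r a b c d = - r a b d c.
  have := cst_curvature_skew a b (vfield_smooth_cst p c) (vfield_smooth_cst p d).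
  by rewrite !cst_field_id (Defs.metric_sym hM p c).
have rB a b c d : r a b c d + r b c a d + r c a b d = 0.
  by rewrite /r -!ipDl Bianchi ip0l.
exact: (pair_symmetry r12 r34 rB u v w z).
Qed.

(** Pair symmetry moves xi(p) to the slot that is differentiated twice, where nabla xi = f id makes
    the computation explicit. *)
Lemma concircular_curvature xi f p u v w : concircular nabla xi f ->
  ip h p (curvature_at nabla p (xi p) u v) w =
  fdiff f p v * ip h p w u - fdiff f p w * ip h p v u.
Proof.
move=> [sxi sf xiE].
have sc := vfield_smooth_cst p.
rewrite curvature_at_cst cst_curvature_pair.
(* Both skewness identities have the same right-hand side, so the coordinate field with value xi(p)
   may be replaced by xi itself. *)
have E1 := cst_curvature_skew v w (sc (xi p)) (sc u).
have E2 := cst_curvature_skew v w (sxi p) (sc u).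
rewrite !cst_field_id in E1 E2.
rewrite E1 -E2.
have E a : (fun q => nabla xi q (cst_field p a q)) = (fun q => f q *: cst_field p a q).
  by apply/funext => q; rewrite xiE.
have L a b : nabla (fun q => nabla xi q (cst_field p a q)) p b =
    fdiff f p b *: a + f p *: nabla (cst_field p a) p b.
  by rewrite E (nabla_leibniz nA (sf p) (sc a)) cst_field_id.
(* Torsion-freeness cancels the two terms in which [f] is not differentiated. *)
have S := nabla_cst_sym (chart_at_dom p) (sc v) (sc w).
rewrite !cst_field_id in S.
have -> : cst_curvature p v w xi = fdiff f p v *: w - fdiff f p w *: v.
  apply: etrans (congr2 (fun x y => x - y) (L w v) (L v w)) _.
  by rewrite S opprD addrACA subrr addr0.
by rewrite ipBl !ipZl.
Qed.

End LeviCivita.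
End Connection.

(** * The pullback connection *)

Section Pullback.
Variables (R : realType) (m n : nat) (M : manifold R m) (N : manifold R n).
Variable iota : M -> N.
Hypothesis iotaS : smooth_map iota.
Implicit Types (p q : M) (u v w : 'rV[R]_m).

Definition local_map p (x : 'rV[R]_m) : 'rV[R]_n :=
  chart_at (iota p) (iota (cinv (chart_at p) x)).

Lemma near_iota p (P : N -> Prop) : (\forall r \near iota p, P r) ->
  \forall q \near p, P (iota q).
Proof. by move=> nP; exact: (iotaS.1 p). Qed.

Lemma near_iota_dom p : \forall q \near p, cdom (chart_at (iota p)) (iota q).
Proof. by apply: near_iota; exact: near_dom. Qed.

Lemma local_map_smooth p j : smooth_at (fun x => local_map p x 0 j) (chart_at p p).
Proof. exact: (iotaS.2 p j). Qed.

Lemma local_map_differentiable p : differentiable (local_map p) (chart_at p p).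
Proof. by apply: differentiable_rV => j; exact/smooth_at_differentiable/local_map_smooth. Qed.

Lemma local_map_smooth_near p : \forall q \near p, forall j,
  smooth_at (fun x => local_map p x 0 j) (chart_at p q).
Proof.
apply: (@filter_forall _ _
  (fun j q => smooth_at (fun x => local_map p x 0 j) (chart_at p q)) (nbhs p)) => j.
exact: (near_cmap (chart_at_dom p) (smooth_at_near (local_map_smooth p j))).
Qed.

Lemma tdiff_linear p (k : R) u v :
  tdiff iota p (k *: u + v) = k *: tdiff iota p u + tdiff iota p v.
Proof. by apply: derive_linear; exact: local_map_differentiable. Qed.

Lemma tdiff0 p : tdiff iota p 0 = 0.
Proof. exact: derive0. Qed.

Lemma tdiffZ p (k : R) u : tdiff iota p (k *: u) = k *: tdiff iota p u.
Proof. by have := tdiff_linear p k u 0; rewrite tdiff0 !addr0. Qed.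

Lemma tdiffD p u v : tdiff iota p (u + v) = tdiff iota p u + tdiff iota p v.
Proof. by have := tdiff_linear p 1 u v; rewrite !scale1r. Qed.

Lemma tdiff_sum p (I : Type) (r : seq I) (F : I -> 'rV[R]_m) :
  tdiff iota p (\sum_(i <- r) F i) = \sum_(i <- r) tdiff iota p (F i).
Proof.
by elim: r => [|i r IH]; rewrite ?big_nil ?tdiff0// !big_cons tdiffD IH.
Qed.

(** In the charts fixed at [p] and [iota p] the differential at a moving [q] becomes a derivative of
    the single map [local_map p]. The neighbourhood is chosen before [w], so that the values of a
    field may be substituted for [w]. *)
Lemma tcoord_tdiff p : \forall q \near p, forall w,
  tcoord (iota p) (iota q) (tdiff iota q w) =
  'D_(tcoord p q w) (local_map p) (chart_at p q).
Proof.
apply: filterS (filterI (near_dom p) (filterI (near_iota_dom p) (local_map_smooth_near p))).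
move=> q [pq [ipq sl]] w; have qq := chart_at_dom q; have iqq := chart_at_dom (iota q).
have dl : differentiable (local_map p) (chart_at p q).
  by apply: differentiable_rV => j; exact/smooth_at_differentiable/sl.
have E : local_map q (chart_at q q) = chart_at (iota q) (iota q).
  by rewrite /local_map cmapK.
have dT : differentiable (fun y => chart_at (iota p) (cinv (chart_at (iota q)) y))
    (local_map q (chart_at q q)) by rewrite E; exact: transition_differentiable.
have C := derive_compose w (local_map_differentiable q) dT.
rewrite E in C; apply: etrans (esym C) _.
apply: etrans _ (@derive_chart _ _ M _ (fun r => chart_at (iota p) (iota r) : 'rV[R]_n)
  p q q w pq qq dl).
apply: near_eq_derive; have nd := near_cinv qq (near_iota_dom q).
by apply: filterS nd => x xd; rewrite /local_map /= cmapK.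
Qed.

Lemma smooth_near_comp p (f : N -> R) : smooth_near (iota p) f ->
  smooth_near p (fun q => f (iota q)).
Proof.
move=> sf; have pp := chart_at_dom p.
apply: (@near_eq_smooth_at _ _ (fun x => f (cinv (chart_at (iota p)) (local_map p x)))).
  by apply: filterS (near_cinv pp (near_iota_dom p)) => x xd; rewrite /local_map cmapK.
apply: (@smooth_at_comp _ _ _ (fun y => f (cinv (chart_at (iota p)) y)) (local_map p)).
  by rewrite /local_map cmapK.
exact: local_map_smooth.
Qed.

Lemma fdiff_comp p (f : N -> R) v : smooth_near (iota p) f ->
  fdiff (fun q => f (iota q)) p v = fdiff f (iota p) (tdiff iota p v).
Proof.
move=> sf; have pp := chart_at_dom p.
have E : local_map p (chart_at p p) = chart_at (iota p) (iota p).
  by rewrite /local_map cmapK.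
have df : differentiable (fun y => f (cinv (chart_at (iota p)) y)) (local_map p (chart_at p p)).
  by rewrite E; exact: smooth_near_differentiable.
have C := derive_compose v (local_map_differentiable p) df.
rewrite E in C; apply: etrans C; apply: near_eq_derive.
by apply: filterS (near_cinv pp (near_iota_dom p)) => x xd; rewrite /local_map /= cmapK.
Qed.

Definition smooth_along p (V : M -> 'rV[R]_n) : Prop :=
  forall j, smooth_near p (fun q => tcoord (iota p) (iota q) (V q) 0 j).

Lemma smooth_along_tdiff p X : vfield_smooth_near p X ->
  smooth_along p (fun q => tdiff iota q (X q)).
Proof.
move=> sX j.
apply: (@near_eq_smooth_near _ _ _ _ (fun q => \sum_(k < m)
  tcoord p q (X q) 0 k * 'D_(delta_mx 0 k) (fun x => local_map p x 0 j) (chart_at p q))).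
  apply: filterS (filterI (tcoord_tdiff p) (local_map_smooth_near p)) => q [-> sl].
  have dl : differentiable (local_map p) (chart_at p q).
    by apply: differentiable_rV => i; exact/smooth_at_differentiable/sl.
  rewrite derive_sum_dir// summxE; apply: eq_bigr => k _.
  by rewrite mxE; congr (_ * _); apply/esym/derive_coord.
apply: smooth_near_sum => k; apply: smooth_nearM; first exact: sX.
have pp := chart_at_dom p.
apply: near_eq_smooth_at (smooth_at_derive (delta_mx 0 k) (local_map_smooth p j)).
by apply: filterS (near_cinvK pp) => x ->.
Qed.

Lemma smooth_alongZ p g V : smooth_near p g -> smooth_along p V ->
  smooth_along p (fun q => g q *: V q).
Proof.
move=> sg sV j; apply: near_eq_smooth_near (smooth_nearM sg (sV j)).
by apply: filterS (near_iota_dom p) => q pq; rewrite tcoordZ// mxE.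
Qed.

(** The components of a pushed-forward coordinate field are directional derivatives of [local_map];
    one more derivative gives second derivatives, to which Schwarz applies. *)
Lemma fdiff_tdiff_cst p (a b : 'rV[R]_m) j :
  fdiff (fun q => tcoord (iota p) (iota q) (tdiff iota q (cst_field p a q)) 0 j) p b =
  'D_b (fun x => 'D_a (fun x => local_map p x 0 j) x) (chart_at p p).
Proof.
apply: near_eq_derive; have pp := chart_at_dom p.
apply: filterS (filterI (near_cinvK pp) (near_cinv pp (filterI (near_dom p)
  (filterI (tcoord_tdiff p) (local_map_smooth_near p))))) => x [xK [px [-> sl]]].
rewrite tcoord_cst_field// derive_coord ?xK//.
apply: differentiable_rV => k; have := sl k; rewrite xK.
exact: smooth_at_differentiable.
Qed.

Lemma fdiff_tdiff_sym p u v j :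
  fdiff (fun q => tcoord (iota p) (iota q) (tdiff iota q (cst_field p u q)) 0 j) p v =
  fdiff (fun q => tcoord (iota p) (iota q) (tdiff iota q (cst_field p v q)) 0 j) p u.
Proof.
apply: etrans (fdiff_tdiff_cst p u v j) _.
apply: etrans (smooth_at_Schwarz v u (local_map_smooth p j)) _.
exact: esym (fdiff_tdiff_cst p v u j).
Qed.

Lemma smooth_along0 p : smooth_along p (fun=> 0).
Proof.
move=> j; apply: near_eq_smooth_near (smooth_near_cst p 0).
by apply: nearW => q; rewrite /tcoord derive0 mxE.
Qed.

Lemma smooth_alongD p V W : smooth_along p V -> smooth_along p W ->
  smooth_along p (fun q => V q + W q).
Proof.
move=> sV sW j; apply: near_eq_smooth_near (smooth_nearD (sV j) (sW j)).
by apply: filterS (near_iota_dom p) => q pq; rewrite tcoordD// mxE.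
Qed.

Lemma smooth_along_sum p (I : Type) (r : seq I) (F : I -> M -> 'rV[R]_n) :
  (forall i, smooth_along p (F i)) -> smooth_along p (fun q => \sum_(i <- r) F i q).
Proof.
move=> sF; elim: r => [|i r IH].
  have -> : (fun q => \sum_(i <- [::]) F i q) = (fun=> 0).
    by apply/funext => q; rewrite big_nil.
  exact: smooth_along0.
have -> : (fun q => \sum_(j <- i :: r) F j q) =
    (fun q => F i q + \sum_(j <- r) F j q).
  by apply/funext => q; rewrite big_cons.
exact: (smooth_alongD (sF i) IH).
Qed.

(* Defined through an opaque proof: unfolding the derivatives during unification
   is intractable. *)
Fact along_diff_key : {d : (M -> 'rV[R]_n) -> M -> 'rV[R]_m -> 'rV[R]_n |
  forall V p v j, d V p v 0 j =
    fdiff (fun q => tcoord (iota p) (iota q) (V q) 0 j) p v}.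
Proof.
exists (fun V p v => \row_j fdiff (fun q => tcoord (iota p) (iota q) (V q) 0 j) p v).
by move=> V p v j; exact: mxE.
Qed.

Definition along_diff := sval along_diff_key.

Lemma along_diffE V p v j : along_diff V p v 0 j =
  fdiff (fun q => tcoord (iota p) (iota q) (V q) 0 j) p v.
Proof. exact: (svalP along_diff_key). Qed.

Lemma along_diff_local p V W v : (\forall q \near p, V q = W q) ->
  along_diff V p v = along_diff W p v.
Proof.
move=> VW; apply/rowP => j.
apply: etrans (along_diffE _ _ _ _) (etrans _ (esym (along_diffE _ _ _ _))).
by apply: near_eq_fdiff; apply: filterS VW => q ->.
Qed.

Lemma along_diffZ p g V v : smooth_near p g -> smooth_along p V ->
  along_diff (fun q => g q *: V q) p v = fdiff g p v *: V p + g p *: along_diff V p v.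
Proof.
move=> sg sV; apply/rowP => j.
have nE : \forall q \near p, tcoord (iota p) (iota q) (g q *: V q) 0 j =
    g q * tcoord (iota p) (iota q) (V q) 0 j.
  by apply: filterS (near_iota_dom p) => q pq; rewrite tcoordZ// mxE.
have E := etrans (near_eq_fdiff v nE) (fdiffM v sg (sV j)).
rewrite tcoord_id in E.
apply: etrans (along_diffE _ _ _ _) (etrans E _).
rewrite [RHS]mxE [X in _ = X + _]mxE [X in _ = _ + X]mxE addrC [V p 0 j * _]mulrC.
by congr (_ + _ * _); exact: esym (along_diffE _ _ _ _).
Qed.

Lemma along_diffD p V W v : smooth_along p V -> smooth_along p W ->
  along_diff (fun q => V q + W q) p v = along_diff V p v + along_diff W p v.
Proof.
move=> sV sW; apply/rowP => j.
have nE : \forall q \near p, tcoord (iota p) (iota q) (V q + W q) 0 j =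
    tcoord (iota p) (iota q) (V q) 0 j + tcoord (iota p) (iota q) (W q) 0 j.
  by apply: filterS (near_iota_dom p) => q pq; rewrite tcoordD// mxE.
rewrite [RHS]mxE; apply: etrans (along_diffE _ _ _ _) _.
apply: etrans (etrans (near_eq_fdiff v nE) (fdiffD v (sV j) (sW j))) _.
exact: congr2 (esym (along_diffE _ _ _ _)) (esym (along_diffE _ _ _ _)).
Qed.

Lemma along_diff_linear p V (k : R) u v : smooth_along p V ->
  along_diff V p (k *: u + v) = k *: along_diff V p u + along_diff V p v.
Proof.
move=> sV; apply/rowP => j; rewrite [RHS]mxE [X in _ = X + _]mxE; apply: etrans (along_diffE _ _ _ _) _.
apply: etrans (fdiff_linear k u v (sV j)) _.
exact: (congr2 (fun a b => k * a + b) (esym (along_diffE _ _ _ _))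
  (esym (along_diffE _ _ _ _))).
Qed.

Section PullbackConnection.
Variable nabla : (N -> 'rV[R]_n) -> N -> 'rV[R]_n -> 'rV[R]_n.
Local Notation pb := (pullback_connection nabla iota).

(** The Christoffel symbols of the chart around [r], at its centre, contracted with [a] and [b]: the
    zeroth-order part of the pullback connection. *)
Definition christoffel (r : N) (a b : 'rV[R]_n) : 'rV[R]_n :=
  \sum_(j < n) a 0 j *: nabla (cst_field r (delta_mx 0 j)) r b.

Lemma christoffel_linearl r (k : R) a a' b :
  christoffel r (k *: a + a') b = k *: christoffel r a b + christoffel r a' b.
Proof.
rewrite /christoffel scaler_sumr -big_split; apply: eq_bigr => j _ /=.
by rewrite !mxE scalerDl scalerA.
Qed.

Lemma pullbackE V p v :
  pb V p v = along_diff V p v + christoffel (iota p) (V p) (tdiff iota p v).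
Proof.
rewrite /pullback_connection big_split; congr (_ + _).
by rewrite [RHS]row_sum_delta; apply: eq_bigr => j _; rewrite (along_diffE V).
Qed.

Lemma pullback_local p V W v : (\forall q \near p, V q = W q) ->
  pb V p v = pb W p v.
Proof.
by move=> VW; rewrite !pullbackE (along_diff_local v VW) (nbhs_singleton VW).
Qed.

Lemma pullback_leibniz p g V v : smooth_near p g -> smooth_along p V ->
  pb (fun q => g q *: V q) p v = fdiff g p v *: V p + g p *: pb V p v.
Proof.
move=> sg sV; rewrite !pullbackE (along_diffZ v sg sV).
have := christoffel_linearl (iota p) (g p) (V p) 0 (tdiff iota p v).
have -> : christoffel (iota p) 0 (tdiff iota p v) = 0.
  by rewrite /christoffel big1// => j _; rewrite mxE scale0r.
by rewrite !addr0 => ->; rewrite scalerDr addrA.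
Qed.

Lemma pullbackD p V W v : smooth_along p V -> smooth_along p W ->
  pb (fun q => V q + W q) p v = pb V p v + pb W p v.
Proof.
move=> sV sW; rewrite !pullbackE (along_diffD v sV sW).
have := christoffel_linearl (iota p) 1 (V p) (W p) (tdiff iota p v).
by rewrite !scale1r => ->; rewrite addrACA.
Qed.

Lemma pullback0 p v : pb (fun=> 0) p v = 0.
Proof.
have := pullback_leibniz v (smooth_near_cst p 0) (smooth_along0 p).
by rewrite fdiff_cst !scale0r addr0.
Qed.

Lemma pullback_sum p (I : Type) (r : seq I) (F : I -> M -> 'rV[R]_n) v :
  (forall i, smooth_along p (F i)) ->
  pb (fun q => \sum_(i <- r) F i q) p v = \sum_(i <- r) pb (F i) p v.
Proof.
move=> sF; elim: r => [|i r IH].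
  have E : (fun q => \sum_(i <- [::]) F i q) = (fun=> 0).
    by apply/funext => q; rewrite big_nil.
  by rewrite E big_nil; exact: pullback0.
have E : (fun q => \sum_(j <- i :: r) F j q) =
    (fun q => F i q + \sum_(j <- r) F j q).
  by apply/funext => q; rewrite big_cons.
rewrite E big_cons -IH; exact: (pullbackD v (sF i) (smooth_along_sum r sF)).
Qed.

Hypothesis nA : affine_connection nabla.

Lemma christoffel_linearr r (k : R) a b b' :
  christoffel r a (k *: b + b') = k *: christoffel r a b + christoffel r a b'.
Proof.
rewrite /christoffel scaler_sumr -big_split; apply: eq_bigr => j _ /=.
rewrite (nabla_linear nA (vfield_smooth_cst _ _)) scalerDr !scalerA.
by rewrite [k * _]mulrC.
Qed.

Lemma pullback_dir_linear p V (k : R) u v : smooth_along p V ->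
  pb V p (k *: u + v) = k *: pb V p u + pb V p v.
Proof.
move=> sV; rewrite !pullbackE (along_diff_linear k u v sV) tdiff_linear.
by rewrite christoffel_linearr scalerDr addrACA.
Qed.

Lemma pullback_comp p X v : vfield_smooth_near (iota p) X ->
  pb (fun q => X (iota q)) p v = nabla X (iota p) (tdiff iota p v).
Proof.
move=> sX; rewrite (nabla_expand nA _ sX) big_split pullbackE; congr (_ + _).
rewrite [LHS]row_sum_delta; apply: eq_bigr => j _; congr (_ *: _).
exact: etrans (along_diffE _ _ _ _) (fdiff_comp v (sX j)).
Qed.

Lemma christoffel_expand r a b : christoffel r a b =
  \sum_(j < n) \sum_(k < n)
    (a 0 j * b 0 k) *: nabla (cst_field r (delta_mx 0 j)) r (delta_mx 0 k).
Proof.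
apply: eq_bigr => j _; rewrite {1}(row_sum_delta b).
rewrite (nabla_dir_sum nA)//; last exact: vfield_smooth_cst.
rewrite scaler_sumr; apply: eq_bigr => k _.
by rewrite (nabla_dirZ nA (b 0 k) _ (vfield_smooth_cst r _)) scalerA.
Qed.

Section PullbackMetric.
Variable h : N -> 'M[R]_n.
Hypotheses (hM : riemannian_metric h) (nLC : levi_civita h nabla).

Lemma christoffel_sym r a b : christoffel r a b = christoffel r b a.
Proof.
rewrite !christoffel_expand exchange_big; apply: eq_bigr => j _ /=.
apply: eq_bigr => k _; rewrite mulrC; congr (_ *: _).
have sc := vfield_smooth_cst r.
have := nabla_cst_sym nLC (chart_at_dom r) (sc (delta_mx 0 j)) (sc (delta_mx 0 k)).
by rewrite !cst_field_id.
Qed.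

(** For commuting fields this is torsion-freeness along [iota]: one part is the symmetry of second
    derivatives, the other that of the Christoffel symbols. *)
Lemma pullback_tdiff_sym p u v :
  pb (fun q => tdiff iota q (cst_field p u q)) p v =
  pb (fun q => tdiff iota q (cst_field p v q)) p u.
Proof.
apply: etrans (pullbackE _ _ _) (etrans _ (esym (pullbackE _ _ _))).
apply: (congr2 +%R); last by rewrite !cst_field_id; exact: christoffel_sym.
apply/rowP => j.
apply: etrans (along_diffE _ _ _ _) (etrans _ (esym (along_diffE _ _ _ _))).
exact: fdiff_tdiff_sym.
Qed.

Definition gram p (j k : 'I_n) (r : N) : R := ip h r (cst_field (iota p) (delta_mx 0 j) r)
  (cst_field (iota p) (delta_mx 0 k) r).

Lemma ip_along_expand p (V W : M -> 'rV[R]_n) : \forall q \near p,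
  ip h (iota q) (V q) (W q) = \sum_(j < n) \sum_(k < n)
    (tcoord (iota p) (iota q) (V q) 0 j * tcoord (iota p) (iota q) (W q) 0 k *
     gram p j k (iota q)).
Proof.
apply: filterS (near_iota_dom p) => q pq.
rewrite [in LHS](vfield_expand (fun=> V q) pq) [in LHS](vfield_expand (fun=> W q) pq).
rewrite ip_suml; apply: eq_bigr => i _; rewrite ipZl ip_sumr mulr_sumr.
by apply: eq_bigr => j _; rewrite ipZr mulrA.
Qed.

Let smooth_gram p j k : smooth_near p (fun q => gram p j k (iota q)).
Proof. exact: (smooth_near_comp (metric_smooth hM _ _ _)). Qed.

Lemma smooth_ip_along p V W : smooth_along p V -> smooth_along p W ->
  smooth_near p (fun q => ip h (iota q) (V q) (W q)).
Proof.
move=> sV sW.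
have E : \forall q \near p, \sum_(j < n) \sum_(k < n)
    (tcoord (iota p) (iota q) (V q) 0 j * tcoord (iota p) (iota q) (W q) 0 k *
     gram p j k (iota q)) = ip h (iota q) (V q) (W q).
  by apply: filterS (ip_along_expand p V W) => q ->.
apply: near_eq_smooth_near E _.
apply: smooth_near_sum => j; apply: smooth_near_sum => k.
exact: (smooth_nearM (smooth_nearM (sV j) (sW k)) (smooth_gram p j k)).
Qed.

Lemma fdiff_gram p j k v : fdiff (fun q => gram p j k (iota q)) p v =
  ip h (iota p) (nabla (cst_field (iota p) (delta_mx 0 j)) (iota p) (tdiff iota p v))
    (delta_mx 0 k) + ip h (iota p) (delta_mx 0 j)
    (nabla (cst_field (iota p) (delta_mx 0 k)) (iota p) (tdiff iota p v)).
Proof.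
apply: etrans (fdiff_comp v (metric_smooth hM (iota p) _ _)) _.
have sc := vfield_smooth_cst (iota p).
apply: etrans (lc_metric nLC (sc (delta_mx 0 j)) (sc (delta_mx 0 k)) _) _.
by rewrite !cst_field_id.
Qed.

(** The algebra of the metric product rule. Components and their derivatives enter as independent
    vectors, so no derivative is unfolded when [ring] compares coefficients. *)
Lemma product_rule_expand (r : N) (a b da db x : 'rV[R]_n) :
  \sum_(j < n) \sum_(k < n)
    (a 0 j * b 0 k *
       (ip h r (nabla (cst_field r (delta_mx 0 j)) r x) (delta_mx 0 k) +
        ip h r (delta_mx 0 j) (nabla (cst_field r (delta_mx 0 k)) r x)) +
     ip h r (delta_mx 0 j) (delta_mx 0 k) * (a 0 j * db 0 k + b 0 k * da 0 j)) =
  ip h r (da + christoffel r a x) b + ip h r a (db + christoffel r b x).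
Proof.
have E (c dc : 'rV[R]_n) : dc + christoffel r c x = \sum_(j < n)
    (dc 0 j *: delta_mx 0 j + c 0 j *: nabla (cst_field r (delta_mx 0 j)) r x).
  by rewrite big_split -row_sum_delta.
rewrite !E [X in ip h r _ X + _](row_sum_delta b) [X in _ + ip h r X _](row_sum_delta a).
rewrite !ip_suml -big_split.
apply: eq_bigr => j _ /=; rewrite !ip_sumr -big_split; apply: eq_bigr => k _ /=.
rewrite !(ipDl, ipDr, ipZl, ipZr).
by ring.
Qed.

(** In the coordinate expansion of <V, W> the Gram coefficients contribute the Christoffel terms, by
    compatibility of the ambient connection, and the components contribute [along_diff]. *)
Lemma pullback_metric p V W v : smooth_along p V -> smooth_along p W ->
  fdiff (fun q => ip h (iota q) (V q) (W q)) p v =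
  ip h (iota p) (pb V p v) (W p) + ip h (iota p) (V p) (pb W p v).
Proof.
move=> sV sW; apply: etrans (near_eq_fdiff v (ip_along_expand p V W)) _.
have sVW j k := smooth_nearM (sV j) (sW k).
have sVWg j k := smooth_nearM (sVW j k) (smooth_gram p j k).
apply: etrans (fdiff_sum (index_enum 'I_n) v
  (fun j => smooth_near_sum (index_enum 'I_n) (sVWg j))) _.
have E j k : fdiff (fun q => tcoord (iota p) (iota q) (V q) 0 j *
    tcoord (iota p) (iota q) (W q) 0 k * gram p j k (iota q)) p v =
  V p 0 j * W p 0 k * (ip h (iota p) (nabla (cst_field (iota p) (delta_mx 0 j)) (iota p)
     (tdiff iota p v)) (delta_mx 0 k) + ip h (iota p) (delta_mx 0 j)
    (nabla (cst_field (iota p) (delta_mx 0 k)) (iota p) (tdiff iota p v))) +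
  ip h (iota p) (delta_mx 0 j) (delta_mx 0 k) *
    (V p 0 j * along_diff W p v 0 k + W p 0 k * along_diff V p v 0 j).
  apply: etrans (fdiffM v (sVW j k) (smooth_gram p j k)) _.
  apply: etrans (congr2 (fun a b => _ * a + _ * b) (fdiff_gram p j k v)
    (fdiffM v (sV j) (sW k))) _.
  rewrite /gram !tcoord_id !cst_field_id.
  exact: (congr2 (fun a b => _ + _ * (_ * a + _ * b)) (esym (along_diffE _ _ _ _))
    (esym (along_diffE _ _ _ _))).
apply: etrans (eq_bigr _ (fun j _ => etrans (fdiff_sum (index_enum 'I_n) v (sVWg j))
  (eq_bigr _ (fun k _ => E j k)))) _.
apply: etrans (product_rule_expand _ _ _ _ _ _) _.
exact: (congr2 (fun x y => ip h (iota p) x (W p) + ip h (iota p) (V p) y)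
  (esym (pullbackE V p v)) (esym (pullbackE W p v))).
Qed.

End PullbackMetric.
End PullbackConnection.
End Pullback.

(** * Gradients and orthonormal frames *)

Section Riesz.
Variables (R : realType) (n : nat) (N : manifold R n) (h : N -> 'M[R]_n).
Hypothesis hM : riemannian_metric h.
Implicit Types (p q : N) (u v w : 'rV[R]_n).

Lemma ip_delta p (i j : 'I_n) : ip h p (delta_mx 0 i) (delta_mx 0 j) = h p i j.
Proof. by rewrite /ip trmx_delta -rowE -colE !mxE. Qed.

Lemma metric_unit p : h p \in unitmx.
Proof.
rewrite -row_free_unit -kermx_eq0; apply/rowV0P => v /sub_kermxP vh.
apply/eqP/negPn/negP => v0; have := metric_pos hM p v0.
by rewrite /ip vh mul0mx mxE ltxx.
Qed.

(** Positivity makes the representing vector unique, so [xget] returns [w] and its default value 0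
    never enters. *)
Lemma sharp_eq p (alpha : 'rV[R]_n -> R) w :
  (forall u, ip h p w u = alpha u) -> sharp h p alpha = w.
Proof.
move=> wE; apply: (ip_eq hM (p := p)) => u; rewrite wE.
by have := @xgetPex _ 0 [set w | forall u, ip h p w u = alpha u]
  (ex_intro _ w wE) u.
Qed.

Lemma sharpE p (alpha : 'rV[R]_n -> R) :
  (forall k u v, alpha (k *: u + v) = k * alpha u + alpha v) ->
  forall u, ip h p (sharp h p alpha) u = alpha u.
Proof.
move=> aL.
have a0 : alpha 0 = 0.
  by have := aL (-1) 0 0; rewrite scaler0 addr0 mulN1r addNr.
have aS (u : 'rV[R]_n) : alpha u = \sum_(j < n) u 0 j * alpha (delta_mx 0 j).
  rewrite {1}(row_sum_delta u); elim: (index_enum _) => [|j r IH].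
    by rewrite !big_nil.
  by rewrite !big_cons aL IH.
(* The solution of the linear system w h = a, where a lists the values of [alpha] on the standard
   basis. *)
pose w := (\row_j alpha (delta_mx 0 j)) *m invmx (h p).
have wE u : ip h p w u = alpha u.
  rewrite /ip /w -[_ *m _ *m h p]mulmxA mulVmx ?metric_unit// mulmx1 aS mxE.
  by apply: eq_bigr => j _; rewrite !mxE mulrC.
by move=> u; rewrite (sharp_eq wE).
Qed.

Lemma smooth_near_gt0 p (f : N -> R) : smooth_near p f -> 0 < f p ->
  \forall q \near p, 0 < f q.
Proof.
move=> sf f0; have pp := chart_at_dom p.
have cf := differentiable_continuous (smooth_near_differentiable sf).
have f0' : 0 < f (cinv (chart_at p) (chart_at p p)) by rewrite cmapK.
exact: (near_chart pp (@cvgr_gt _ _ (nbhs (chart_at p p)) _ _ _ cf 0 f0')).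
Qed.

(** Gram-Schmidt on fields, one vector at a time. The new vector is chosen orthogonal at [p] to the
    earlier ones, so the correction vanishes at [p] and the corrected field stays nonzero nearby. *)
Lemma near_orthonormal_family p k : (k <= n)%N -> exists e : 'I_k -> N -> 'rV[R]_n,
  (forall i, vfield_smooth_near p (e i)) /\
  (\forall q \near p, forall i j, ip h q (e i q) (e j q) = (i == j)%:R).
Proof.
elim: k => [|k IH] kn.
  by exists (fun _ _ => 0); split => [[]//|]; apply: nearW => q [].
have [e [se oe]] := IH (ltnW kn).
have [v v0 vp] : exists2 v, v != 0 & forall i, ip h p v (e i p) = 0.
  (* [A] has n rows and k columns with k < n, so its left kernel is nonzero; its elements are
     orthogonal to every [e i p]. *)
  pose A := h p *m (\matrix_(i < k) e i p)^T.
  have kA : kermx A != 0.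
    rewrite -mxrank_eq0 mxrank_ker -lt0n subn_gt0.
    exact: leq_ltn_trans (rank_leq_col _) kn.
  exists (nz_row (kermx A)); first by rewrite nz_row_eq0.
  move=> i; have /sub_kermxP K : (nz_row (kermx A) <= kermx A)%MS by exact: nz_row_sub.
  have := congr1 (fun B : 'rV[R]_k => B 0 i) K.
  rewrite /A mulmxA mxE [RHS]mxE => S; rewrite /ip mxE -[RHS]S.
  by apply: eq_bigr => j _; rewrite !mxE.
have sv := vfield_smooth_cst p v.
pose W q := cst_field p v q +
  (\sum_(i < k) (- 1 * ip h q (cst_field p v q) (e i q)) *: e i q).
have sW : vfield_smooth_near p W.
  exact: (vfield_smoothD sv (vfield_smooth_sum _ (fun i => vfield_smoothZ
    (smooth_nearM (smooth_near_cst p (-1)) (smooth_ip hM sv (se i))) (se i)))).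
have Wp : W p = v.
  rewrite /W cst_field_id big1 ?addr0// => i _.
  by rewrite vp mulr0 scale0r.
have sWW := smooth_ip hM sW sW.
have WW0 : 0 < ip h p (W p) (W p) by rewrite Wp; exact: (metric_pos hM).
pose s q := (Num.sqrt (ip h q (W q) (W q)))^-1.
have ss : smooth_near p s.
  have WW0' : 0 < (fun x => ip h (cinv (chart_at p) x) (W (cinv (chart_at p) x))
      (W (cinv (chart_at p) x))) (chart_at p p).
    by rewrite /= cmapK//; exact: chart_at_dom.
  exact: (smooth_at_invsqrt sWW WW0').
(* The index [ord_max] receives the new normalized field; [unlift] recovers the old index of the
   others. *)
pose e' (i : 'I_k.+1) := if unlift ord_max i is Some j then e j
  else (fun q => s q *: W q).
exists e'; split.
  move=> i; rewrite /e'; case: unliftP => [j _|_]; first exact: se.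
  exact: (vfield_smoothZ ss sW).
apply: filterS (filterI oe (smooth_near_gt0 sWW WW0)) => q [oq WWq].
have We j : ip h q (W q) (e j q) = 0.
  rewrite /W ipDl ip_suml (bigD1 j)//= big1; last first.
    by move=> i ij; rewrite ipZl oq (negbTE ij) mulr0.
  by rewrite ipZl oq eqxx mulr1 addr0 mulN1r subrr.
move=> i j; rewrite /e'; case: (unliftP ord_max i) => [i' ->|->];
  case: (unliftP ord_max j) => [j' ->|->].
- by rewrite oq (inj_eq lift_inj).
- rewrite ipZr (Defs.metric_sym hM) We mulr0.
  by rewrite [lift _ _ == _]eq_sym (negbTE (neq_lift _ _)).
- by rewrite ipZl We mulr0 (negbTE (neq_lift _ _)).
- rewrite ipZl ipZr eqxx /s mulrA -expr2 exprVn sqr_sqrtr ?ltW//.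
  by rewrite mulVf// gt_eqF.
Qed.

Lemma orthonormal_frame_exists p : exists e, orthonormal_frame_near h p e.
Proof. exact: (near_orthonormal_family p (leqnn n)). Qed.

(** Orthonormality reads E h E^T = 1 for the square matrix [E] with rows e_i; a one-sided inverse is
    two-sided, so h E^T E = 1. This converts traces with g^{ij} into sums over a frame. *)
Lemma frame_gram_inv p (e : 'I_n -> 'rV[R]_n) :
  (forall i j, ip h p (e i) (e j) = (i == j)%:R) ->
  invmx (h p) = (\matrix_(i < n) e i)^T *m (\matrix_(i < n) e i).
Proof.
move=> oe; set E := \matrix_(i < n) e i.
have E1 : E *m (h p *m E^T) = 1%:M.
  apply/matrixP => i j; rewrite mulmxA [RHS]mxE -oe /ip [LHS]mxE [RHS]mxE.
  apply: eq_bigr => k _; rewrite !mxE; congr (_ * _).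
  by apply: eq_bigr => l _; rewrite !mxE.
have {}E1 := mulmx1C E1; rewrite -mulmxA in E1.
by rewrite -[LHS]mulmx1 -E1 [LHS]mulmxA mulVmx ?metric_unit// mul1mx.
Qed.

Lemma frame_expand p (e : 'I_n -> 'rV[R]_n) u :
  (forall i j, ip h p (e i) (e j) = (i == j)%:R) ->
  \sum_(i < n) ip h p u (e i) *: e i = u.
Proof.
move=> oe; rewrite -[RHS]mulmx1 -(mulmxV (metric_unit p)) (frame_gram_inv oe).
rewrite !mulmxA [RHS]mulmx_sum_row; apply: eq_bigr => i _.
rewrite rowK; congr (_ *: _); rewrite /ip [LHS]mxE [RHS]mxE.
by apply: eq_bigr => k _; rewrite !mxE.
Qed.

End Riesz.

(** * The induced metric *)

Section InducedMetric.
Variables (R : realType) (m n : nat) (M : manifold R m) (N : manifold R n).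
Variables (iota : M -> N) (h : N -> 'M[R]_n).
Hypotheses (hM : riemannian_metric h) (iotaS : submanifold iota).
Let g := induced_metric h iota.
Let sm := sub_smooth iotaS.

Lemma ip_induced p u v :
  ip g p u v = ip h (iota p) (tdiff iota p u) (tdiff iota p v).
Proof.
rewrite (row_sum_delta u) (row_sum_delta v) !(tdiff_sum sm) !ip_suml.
apply: eq_bigr => i _; rewrite !ip_sumr; apply: eq_bigr => j _.
by rewrite !(tdiffZ sm) !ipZl !ipZr ip_delta mxE.
Qed.

End InducedMetric.

Lemma skew_from_sums (R : realType) (t t' x x' y y' : R) :
  t = x - y -> t' = x' - y' -> x + x' = y + y' -> t = - t'.
Proof. by move=> -> -> E; lra. Qed.

(** Three symmetric and three skew transpositions, applied alternately, return to the initial triple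
    with sign -1. *)
Lemma sym_skew_eq0 (R : realType) (V : Type) (T : V -> V -> V -> R) :
  (forall a b c, T a b c = T b a c) -> (forall a b c, T a b c = - T a c b) ->
  forall a b c, T a b c = 0.
Proof.
move=> Ts Tk a b c; have : T a b c = - T a b c.
  by rewrite {1}Ts Tk Ts Tk opprK Ts Tk.
by lra.
Qed.

Lemma linear_sub (R : pzRingType) (V : lmodType R) (k : R) (a b c d : V) :
  k *: a + b - (k *: c + d) = k *: (a - c) + (b - d).
Proof. by rewrite scalerBr opprD addrACA. Qed.

(** * The Gauss formula and the tension field *)

Section Submanifold.
Variables (R : realType) (m n : nat) (M : manifold R m) (N : manifold R n).
Variables (iota : M -> N) (h : N -> 'M[R]_n).
Variable nablaN : (N -> 'rV[R]_n) -> N -> 'rV[R]_n -> 'rV[R]_n.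
Variable nablaM : (M -> 'rV[R]_m) -> M -> 'rV[R]_m -> 'rV[R]_m.
Hypotheses (hM : riemannian_metric h) (NLC : levi_civita h nablaN).
Hypotheses (iotaS : submanifold iota).
Hypothesis MLC : levi_civita (induced_metric h iota) nablaM.
Let g := induced_metric h iota.
Let sm := sub_smooth iotaS.
Let nNA := lc_connection NLC.
Let nMA := lc_connection MLC.
Local Notation pb := (pullback_connection nablaN iota).
Implicit Types (p q : M) (u v w : 'rV[R]_m).

(** Positivity is where injectivity of the differential enters. *)
Lemma induced_riemannian : riemannian_metric g.
Proof.
split=> [p u v|p u u0|p u v].
- by rewrite !(ip_induced h iotaS) (Defs.metric_sym hM).
- rewrite (ip_induced h iotaS); apply: (metric_pos hM).
  apply/negP => /eqP du; move/negP: u0; apply; apply/eqP.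
  by apply: (sub_immersion iotaS (p := p)); rewrite du (tdiff0 iota).
- have sV w := smooth_along_tdiff sm (vfield_smooth_cst p w).
  apply: near_eq_smooth_near (smooth_ip_along sm hM (sV u) (sV v)).
  by apply: nearW => q; rewrite (ip_induced h iotaS).
Qed.

(* Off the coordinate fields this is still the second fundamental form of the
   values of [u] and [V]. *)
Definition gauss_defect (V : M -> 'rV[R]_m) p u : 'rV[R]_n :=
  pb (fun q => tdiff iota q (V q)) p u - tdiff iota p (nablaM V p u).

(* [T] is symmetric in its first two arguments because both connections are
   torsion-free, and skew in the last two because both are metric. *)
Lemma gauss_defect_normal p u v w :
  ip h (iota p) (gauss_defect (cst_field p v) p u) (tdiff iota p w) = 0.
Proof.
pose T a b c := ip h (iota p) (gauss_defect (cst_field p b) p a) (tdiff iota p c).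
have sc := vfield_smooth_cst p.
have Tsym a b c : T a b c = T b a c.
  have E1 := pullback_tdiff_sym sm nNA NLC p b a.
  have E2 := nabla_cst_sym MLC (chart_at_dom p) (sc a) (sc b).
  rewrite !cst_field_id in E2.
  exact: (congr2 (fun x y => ip h (iota p) (x - tdiff iota p y) (tdiff iota p c)) E1 E2).
have Tskew a b c : T a b c = - T a c b.
  have sV d := smooth_along_tdiff sm (sc d).
  have E1 := pullback_metric sm hM NLC a (sV b) (sV c).
  have E2 := lc_metric MLC (sc b) (sc c) a.
  have E3 : fdiff (fun q => ip h (iota q) (tdiff iota q (cst_field p b q))
      (tdiff iota q (cst_field p c q))) p a =
    fdiff (fun q => ip g q (cst_field p b q) (cst_field p c q)) p a.
    apply: near_eq_fdiff; apply: nearW => q.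
    exact: esym (ip_induced h iotaS q _ _).
  have E := etrans (esym E1) (etrans E3 E2).
  rewrite !cst_field_id !(ip_induced h iotaS) in E.
  pose X b c := ip h (iota p) (pb (fun q => tdiff iota q (cst_field p b q)) p a)
    (tdiff iota p c).
  pose Y b c := ip h (iota p) (tdiff iota p (nablaM (cst_field p b) p a))
    (tdiff iota p c).
  have D b' c' : T a b' c' = X b' c' - Y b' c' by exact: ipBl.
  have SX : ip h (iota p) (tdiff iota p b) (pb (fun q => tdiff iota q (cst_field p c q)) p a)
    = X c b := Defs.metric_sym hM _ _ _.
  have SY : ip h (iota p) (tdiff iota p b) (tdiff iota p (nablaM (cst_field p c) p a))
    = Y c b := Defs.metric_sym hM _ _ _.
  have {}E : X b c + X c b = Y b c + Y c b.
    by rewrite SX SY in E; exact: E.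
  exact: (skew_from_sums (D b c) (D c b) E).
exact: (sym_skew_eq0 Tsym Tskew u v w).
Qed.

(** The derivatives of the components of [V] enter both connections with the same coefficients and
    cancel, so only the value V(p) remains. *)
Lemma gauss_defect_expand p V u : vfield_smooth_near p V ->
  gauss_defect V p u =
  \sum_(j < m) V p 0 j *: gauss_defect (cst_field p (delta_mx 0 j)) p u.
Proof.
move=> sV; have sc := vfield_smooth_cst p.
have [a [E1 E2]] : exists a : 'I_m -> R,
  pb (fun q => tdiff iota q (V q)) p u = \sum_(j < m)
    (a j *: tdiff iota p (delta_mx 0 j) + V p 0 j *:
      pb (fun q => tdiff iota q (cst_field p (delta_mx 0 j) q)) p u) /\
  nablaM V p u = \sum_(j < m) (a j *: delta_mx 0 j + V p 0 j *:
      nablaM (cst_field p (delta_mx 0 j)) p u).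
  exists (fun j => fdiff (fun q => tcoord p q (V q) 0 j) p u); split; last first.
    exact: (nabla_expand nMA u sV).
  have st j := smooth_along_tdiff sm (sc (delta_mx 0 j)).
  have nE : \forall q \near p, tdiff iota q (V q) = \sum_(j < m)
      tcoord p q (V q) 0 j *: tdiff iota q (cst_field p (delta_mx 0 j) q).
    apply: filterS (near_dom p) => q pq.
    rewrite {1}(vfield_expand V pq) (tdiff_sum sm).
    by apply: eq_bigr => j _; rewrite (tdiffZ sm).
  apply: etrans (pullback_local iota nablaN u nE) _.
  apply: etrans (pullback_sum sm nablaN _ u
    (fun j => smooth_alongZ sm (sV j) (st j))) _.
  apply: eq_bigr => j _; apply: etrans (pullback_leibniz sm nablaN u (sV j) (st j)) _.
  by rewrite cst_field_id tcoord_id.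
rewrite /gauss_defect E1 E2 (tdiff_sum sm) -sumrB; apply: eq_bigr => j _.
rewrite (tdiffD sm) !(tdiffZ sm) scalerBr opprD addrACA.
by rewrite subrr add0r.
Qed.

Lemma gauss_defect_dir p v (k : R) u u' :
  gauss_defect (cst_field p v) p (k *: u + u') =
  k *: gauss_defect (cst_field p v) p u + gauss_defect (cst_field p v) p u'.
Proof.
have sc := vfield_smooth_cst p v.
have E1 := pullback_dir_linear sm nNA k u u' (smooth_along_tdiff sm sc).
have E2 : tdiff iota p (nablaM (cst_field p v) p (k *: u + u')) =
    k *: tdiff iota p (nablaM (cst_field p v) p u)
    + tdiff iota p (nablaM (cst_field p v) p u').
  by rewrite (nabla_linear nMA sc) (tdiff_linear sm).
apply: etrans (congr2 (fun x y => x - y) E1 E2) _; exact: linear_sub.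
Qed.

Lemma gauss_defect_dir_sum p v (I : Type) (r : seq I) (a : I -> R) (F : I -> 'rV[R]_m) :
  gauss_defect (cst_field p v) p (\sum_(i <- r) a i *: F i) =
  \sum_(i <- r) a i *: gauss_defect (cst_field p v) p (F i).
Proof.
have z : gauss_defect (cst_field p v) p 0 = 0.
  have := gauss_defect_dir p v (-1) 0 0.
  by rewrite scaler0 addr0 scaleN1r addNr.
elim: r => [|i r IH]; first by rewrite !big_nil.
by rewrite !big_cons gauss_defect_dir IH.
Qed.

(** Since the defect is normal, the intrinsic derivative is exactly the tangential part that
    [normal_part] removes. *)
Lemma second_fundamental_formE p u v :
  second_fundamental_form h nablaN iota p u v = gauss_defect (cst_field p v) p u.
Proof.
rewrite /second_fundamental_form /normal_part /gauss_defect; congr (_ - tdiff _ _ _).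
apply: (sharp_eq induced_riemannian) => w; rewrite (ip_induced h iotaS).
have := gauss_defect_normal p u v w; rewrite /gauss_defect ipBl.
by move/eqP; rewrite subr_eq0 => /eqP.
Qed.

Lemma mean_curvature_normal p w :
  ip h (iota p) (mean_curvature h nablaN iota p) (tdiff iota p w) = 0.
Proof.
rewrite /mean_curvature ipZl ip_suml big1 ?mulr0// => i _.
rewrite ip_suml big1// => j _; rewrite ipZl second_fundamental_formE.
by rewrite gauss_defect_normal mulr0.
Qed.

(** The defect is bilinear in the values of its two slots, so the frame sum contracts the second
    fundamental form with E^T E, the inverse Gram matrix; m > 0 cancels the factor 1/m in H. *)
Lemma gauss_defect_trace p e : (0 < m)%N -> orthonormal_frame_near g p e ->
  \sum_(i < m) gauss_defect (e i) p (e i p) = m%:R *: mean_curvature h nablaN iota p.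
Proof.
move=> m0 [se /nbhs_singleton oe].
rewrite /mean_curvature scalerA mulfV ?pnatr_eq0 -?lt0n// scale1r.
rewrite (frame_gram_inv induced_riemannian oe).
pose B i j := gauss_defect (cst_field p (delta_mx 0 j)) p (delta_mx 0 i).
transitivity (\sum_(l < m) \sum_(j < m) \sum_(i < m) (e l p 0 j * e l p 0 i) *: B i j).
  apply: eq_bigr => l _; rewrite (gauss_defect_expand _ (se l)); apply: eq_bigr => j _.
  rewrite {2}(row_sum_delta (e l p)) gauss_defect_dir_sum scaler_sumr.
  by apply: eq_bigr => i _; rewrite scalerA.
rewrite exchange_big [RHS]exchange_big; apply: eq_bigr => j _ /=.
rewrite exchange_big; apply: eq_bigr => i _ /=.
rewrite second_fundamental_formE -scaler_suml; congr (_ *: _).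
by rewrite mxE; apply: eq_bigr => l _; rewrite !mxE mulrC.
Qed.

Lemma normal_part_ortho p w (a : 'rV[R]_n) :
  ip h (iota p) (normal_part h iota p a) (tdiff iota p w) = 0.
Proof.
rewrite /normal_part ipBl -(ip_induced h iotaS) (sharpE induced_riemannian) ?subrr//.
by move=> k u v; rewrite (tdiff_linear sm) ipDr ipZr.
Qed.

(** * The tension field of a concircular vector field *)

Section Concircular.
Variables (xi : N -> 'rV[R]_n) (f : N -> R).
Hypotheses (xi_conc : concircular nablaN xi f) (f_neq0 : forall r : N, f r != 0).
Hypothesis m_gt0 : (0 < m)%N.
Let G p := grad h f (iota p).
Let Gm p := grad g (fun q => f (iota q)) p.
Let H := mean_curvature h nablaN iota.

Let sf : smooth f. Proof. by have [] := xi_conc. Qed.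

Lemma grad_ambientE p (z : 'rV[R]_n) : ip h (iota p) (G p) z = fdiff f (iota p) z.
Proof. by apply: (sharpE hM) => k u v; exact: (fdiff_linear k u v (sf (iota p))). Qed.

Lemma grad_inducedE p u : ip g p (Gm p) u = fdiff f (iota p) (tdiff iota p u).
Proof.
have sfi := smooth_near_comp sm (sf (iota p)).
rewrite -(fdiff_comp sm u (sf (iota p))).
by apply: (sharpE induced_riemannian) => k v w; exact: (fdiff_linear k v w sfi).
Qed.

Lemma normal_part_grad p : normal_part h iota p (G p) = G p - tdiff iota p (Gm p).
Proof.
rewrite /normal_part; congr (_ - tdiff _ _ _).
apply: (sharp_eq induced_riemannian) => u.
by rewrite grad_inducedE grad_ambientE.
Qed.

Lemma xi_tensionE p e : orthonormal_frame_near g p e ->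
  xi_tension h nablaM nablaN xi iota e p =
  f (iota p) *: ((2 - m%:R) *: tdiff iota p (Gm p) +
    m%:R *: (f (iota p) *: H p - normal_part h iota p (G p))).
Proof.
move=> oe; have [se /nbhs_singleton on] := oe.
have [sxi _ xiE] := xi_conc.
have st i := smooth_along_tdiff sm (se i).
have sfi := smooth_near_comp sm (sf (iota p)).
set F := f (iota p).
(* Along [iota] the derivative of xi is f d iota. The next derivative yields e_i(f) d iota(e_i),
   which sums to grad^M f, and f times the Gauss defect, which sums to m f H. *)
have lap : \sum_(i < m) (pb (fun q => pb (fun q => xi (iota q)) q (e i q)) p (e i p)
     - pb (fun q => xi (iota q)) p (nablaM (e i) p (e i p))) =
   tdiff iota p (Gm p) + F *: (m%:R *: H p).
  rewrite -(gauss_defect_trace m_gt0 oe) -(frame_expand induced_riemannian (Gm p) on).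
  rewrite (tdiff_sum sm) scaler_sumr -big_split; apply: eq_bigr => i _ /=.
  have E q (w : 'rV[R]_m) : pb (fun q => xi (iota q)) q w = f (iota q) *: tdiff iota q w.
    apply: etrans (pullback_comp sm nNA w (sxi (iota q))) _; exact: xiE.
  have -> : (fun q => pb (fun q => xi (iota q)) q (e i q)) =
      (fun q => f (iota q) *: tdiff iota q (e i q)).
    by apply/funext => q; exact: E.
  rewrite E; apply: etrans (congr1 (fun x => x - _)
    (pullback_leibniz sm nablaN (e i p) sfi (st i))) _.
  rewrite (fdiff_comp sm _ (sf (iota p))) grad_inducedE (tdiffZ sm).
  by rewrite /gauss_defect scalerBr addrA.
have adj (a : 'rV[R]_n) : adjoint_at h (iota p) (nablaN xi (iota p)) a = F *: a.
  by apply: (sharp_eq hM) => u; rewrite xiE ipZl ipZl (Defs.metric_sym hM).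
apply: etrans (congr1 (fun a => _ + adjoint_at h (iota p) (nablaN xi (iota p)) a) lap) _.
rewrite adj normal_part_grad; apply: (ip_eq hM (p := iota p)) => z.
(* The curvature is known only through inner products, so the identity is tested against an
   arbitrary ambient [z]. As e_i is a unit vector, each summand is f (e_i(f) <e_i, z> - z(f)). *)
have curv : ip h (iota p) (\sum_(i < m) curvature_at nablaN (iota p) (xi (iota p))
    (nablaN xi (iota p) (tdiff iota p (e i p))) (tdiff iota p (e i p))) z =
  F * (ip h (iota p) (tdiff iota p (Gm p)) z - m%:R * ip h (iota p) (G p) z).
  rewrite -{1}(frame_expand induced_riemannian (Gm p) on) (tdiff_sum sm) !ip_suml.
  rewrite mulr_natl -[X in _ *+ X]card_ord -sumr_const -sumrB mulr_sumr.
  apply: eq_bigr => i _.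
  rewrite (concircular_curvature hM NLC _ _ _ _ xi_conc) xiE -/F.
  rewrite !ipZr (tdiffZ sm) ipZl grad_inducedE grad_ambientE.
  have -> : ip h (iota p) (tdiff iota p (e i p)) (tdiff iota p (e i p)) = 1.
    by rewrite -(ip_induced h iotaS) on eqxx.
  rewrite (Defs.metric_sym hM _ z).
  move: (fdiff _ _ (tdiff _ _ _)) (fdiff _ _ z) => a b; ring.
rewrite ipDl curv; move: (H p) => Hp; rewrite !(ipBl, ipDl, ipZl).
ring.
Qed.

Lemma generalized_xi_parallelP :
  generalized_xi_parallel h nablaM nablaN xi iota <->
  (forall p, (m%:R - 2) *: Gm p = 0) /\
  (forall p, f (iota p) *: H p - normal_part h iota p (G p) = 0).
Proof.
split=> [par|[tan nor] p e oe]; last first.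
  rewrite (xi_tensionE oe) nor -opprB scaleNr -(tdiffZ sm) tan (tdiff0 iota).
  by rewrite oppr0 scaler0 addr0 scaler0.
suff E p : (m%:R - 2) *: Gm p = 0 /\
    f (iota p) *: H p - normal_part h iota p (G p) = 0.
  by split => p; have [] := E p.
(* The hypothesis speaks of all frames, so it yields information at [p] only once a frame exists
   there. *)
have [e oe] := orthonormal_frame_exists induced_riemannian p.
have := par p e oe; rewrite (xi_tensionE oe) => /eqP.
rewrite scaler_eq0 (negbTE (f_neq0 _)) /= => /eqP E.
have tan : (m%:R - 2) *: Gm p = 0.
  (* Pairing with tangent vectors removes H and the normal part of grad^N f; what remains is an
     identity for the nondegenerate induced metric. *)
  apply: (ip_eq induced_riemannian (p := p)) => u; rewrite ip0l.
  have := congr1 (fun a => ip h (iota p) a (tdiff iota p u)) E.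
  rewrite /= ip0l ipDl !ipZl ipBl ipZl mean_curvature_normal normal_part_ortho.
  by rewrite mulr0 subr0 mulr0 addr0 -(ip_induced h iotaS) -opprB mulNr
    => /eqP; rewrite oppr_eq0 => /eqP.
(* With the tangential part gone, m times the normal bracket vanishes, and m > 0 allows division. *)
split => //; move: E; rewrite -opprB scaleNr -(tdiffZ sm) tan (tdiff0 iota) oppr0 add0r.
by move/eqP; rewrite scaler_eq0 pnatr_eq0 -[m == 0%N]negbK -lt0n m_gt0 /= => /eqP.
Qed.

Lemma grad_eq0_normal p : Gm p = 0 ->
  normal_part h iota p (G p) = G p.
Proof. by move=> G0; rewrite normal_part_grad G0 (tdiff0 iota) subr0. Qed.

End Concircular.
End Submanifold.

(** * Constancy from a vanishing differential, and the characterization of parallel submanifolds *)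

Lemma grad_eq0_constant (R : realType) (m : nat) (M : manifold R m) (f : M -> R) :
  smooth f -> (forall p v, fdiff f p v = 0) -> exists k, forall p, f p = k.
Proof.
move=> sf df0.
(* In the chart the derivative vanishes on a ball, which contains the segments from its centre; the
   mean value theorem along them gives local constancy. *)
have loc p : \forall q \near p, f q = f p.
  have pp := chart_at_dom p.
  have n0 : \forall x \near chart_at p p,
      differentiable (fun x => f (cinv (chart_at p) x)) x /\
      forall v, 'D_v (fun x => f (cinv (chart_at p) x)) x = 0.
    have sx : \forall x \near chart_at p p,
        smooth_at (fun x => f (cinv (chart_at p) x)) x by exact: smooth_at_near (sf p).
    apply: filterS (filterI sx (filterI (near_cinvK pp) (near_cinv pp (near_dom p)))).
    move=> x [sx' [xK px]]; split; first exact: smooth_at_differentiable.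
    move=> v; have := df0 (cinv (chart_at p) x) (cst_field p v (cinv (chart_at p) x)).
    rewrite (fdiff_chart _ px) ?tcoord_cst_field ?xK//.
    exact: smooth_at_differentiable.
  apply: (near_chart pp); move/nbhs_ballP : n0 => [r /= r0 rB].
  apply/nbhs_ballP; exists r => //= y xy.
  have bt t : 0 <= t <= 1 ->
      ball (chart_at p p) r (chart_at p p + t *: (y - chart_at p p)).
    move=> /andP[t0 t1]; move: xy; rewrite -!ball_normE /= opprD addrA subrr sub0r normrN.
    apply: le_lt_trans; rewrite normrZ ger0_norm// distrC.
    by rewrite -[leRHS]mul1r ler_wpM2r.
  have [|c c01 E] := @line_MVT _ _ (fun x => f (cinv (chart_at p) x)) (chart_at p p)
    (y - chart_at p p) 1 ltr01.
    by move=> t /bt /rB[].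
  move: E; rewrite (rB _ (bt _ c01)).2 mul0r scale1r addrCA subrr addr0 cmapK//.
  by move/eqP; rewrite subr_eq0 => /eqP.
(* Connectedness does not exclude the empty manifold, for which any constant will do. *)
have [[p0 _]|M0] := pselect ([set: M] !=set0); last first.
  by exists 0 => p; case: M0; exists p.
(* Local constancy makes this nonempty level set both open and closed, so by connectedness it is all
   of M. *)
exists (f p0); pose B := [set q | f q = f p0].
have oB : open B.
  rewrite openE => q Bq; apply: filterS (loc q) => r; rewrite /B /= => ->; exact: Bq.
have cB : closed B.
  rewrite -[B]setCK; apply: open_closedC; rewrite openE => q Bq.
  by apply: filterS (loc q) => r rq Br; apply: Bq; rewrite /B /= -rq.
have BT : B = [set: M].
  apply: (@manifold_connected _ _ M).
  - by exists p0.
  - by exists B => //; rewrite setTI.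
  - by exists B => //; rewrite setTI.
by move=> p; have : [set: M] p by []; rewrite -BT.
Qed.

Theorem theorem12 (R : realType) (m n : nat) (c : R)
  (N : manifold R n) (h : N -> 'M[R]_n)
  (nablaN : (N -> 'rV[R]_n) -> N -> 'rV[R]_n -> 'rV[R]_n)
  (M : manifold R m) (iota : M -> N)
  (nablaM : (M -> 'rV[R]_m) -> M -> 'rV[R]_m -> 'rV[R]_m)
  (xi : N -> 'rV[R]_n) (f : N -> R)
  (m_gt0 : (0 < m)%N)
  (h_metric : riemannian_metric h)
  (nablaN_lc : levi_civita h nablaN)
  (N_curv : constant_sectional_curvature h nablaN c)
  (M_sub : submanifold iota)
  (nablaM_lc : levi_civita (induced_metric h iota) nablaM)
  (xi_conc : concircular nablaN xi f)
  (f_neq0 : forall p, f p != 0) :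
  (generalized_xi_parallel h nablaM nablaN xi iota <->
     (forall p : M,
        (m%:R - 2) *: grad (induced_metric h iota) (fun q => f (iota q)) p = 0)
     /\ (forall p : M,
          f (iota p) *: mean_curvature h nablaN iota p
          - normal_part h iota p (grad h f (iota p)) = 0))
  /\
  (m <> 2%N ->
   (generalized_xi_parallel h nablaM nablaN xi iota <->
      (exists k : R, forall p : M, f (iota p) = k)
      /\ (forall p : M,
           f (iota p) *: mean_curvature h nablaN iota p = grad h f (iota p)))).
Proof.
have P := generalized_xi_parallelP h_metric nablaN_lc M_sub nablaM_lc xi_conc f_neq0 m_gt0.
have gE := grad_inducedE h_metric M_sub xi_conc.
have nE := grad_eq0_normal h_metric M_sub xi_conc.
have sf : smooth f by case: xi_conc.
have sm := sub_smooth M_sub.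
split=> // m2; apply: iff_trans P _; split=> [[tan nor]|[[k fk] nor]].
  have m20 : (m%:R - 2 : R) != 0 by rewrite subr_eq0 eqr_nat; apply/eqP.
  have G0 p : grad (induced_metric h iota) (fun q => f (iota q)) p = 0.
    by have /eqP := tan p; rewrite scaler_eq0 (negbTE m20) /= => /eqP.
  split=> [|p].
    apply: (grad_eq0_constant (f := fun q => f (iota q))) => [p|p v].
      exact: (smooth_near_comp sm (sf (iota p))).
    apply: etrans (fdiff_comp sm v (sf (iota p))) _.
    by rewrite -gE G0 ip0l.
  by have /eqP := nor p; rewrite (nE _ (G0 p)) subr_eq0 => /eqP.
(* Constancy along M gives back grad^M f = 0, so the tangential condition holds and the projection
   again fixes grad^N f. *)
have G0 p : grad (induced_metric h iota) (fun q => f (iota q)) p = 0.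
  apply: (ip_eq (induced_riemannian h_metric M_sub) (p := p)) => u.
  rewrite gE ip0l -(fdiff_comp sm u (sf (iota p))).
  apply: etrans (fdiff_cst p k u); apply: near_eq_fdiff; exact: nearW.
by split=> p; rewrite ?G0 ?scaler0// (nE _ (G0 p)) nor subrr.
Qed.
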